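(* Let $\gamma$ be a translation invariant quasilocal specification and $\nu\in\mathcal G_{\mathrm{inv}}(\gamma)$. Then $h(\mu|\nu)$ exists for all $\mu\in\mathcal M_{1,\mathrm{inv}}^+$, and for all $\mu\in\mathcal M_{1,\mathrm{inv}}^+$ $$\mu\in\mathcal G_{\mathrm{inv}}(\gamma)\iff h(\mu|\nu)=0.$$
   Context: $E$ is a finite set, $\Omega=E^{\mathbb Z^d}$ with product topology and Borel $\sigma$-field $\mathcal F$. $\mathcal S$ is the set of finite subsets of $\mathbb Z^d$; $\mathcal F_\Lambda$ is the $\sigma$-field generated by the coordinates in $\Lambda$; $\sigma_\Lambda$ is the restriction of $\sigma$ to $\Lambda$. A function is local if it is $\mathcal F_\Delta$-measurable for some $\Delta\in\mathcal S$; $C(\Omega)$ is the set of continuous functions. Translations: $(\tau_x\omega)(y)=\omega(x+y)$. $\mathcal M_{1,\mathrm{inv}}^+$ is the set of translation invariant probability measures on $\Omega$. A specification is a family $\gamma=\{\gamma_\Lambda\}_{\Lambda\in\mathcal S}$ of probability kernels from $\Omega_{\Lambda^c}=E^{\Lambda^c}$ to $\mathcal F$ that is proper ($\gamma_\Lambda(B|\omega)=\mathbf 1_B(\omega)$ for $B\in\mathcal F_{\Lambda^c}$, all $\omega$) and consistent ($\gamma_{\Lambda'}\gamma_\Lambda=\gamma_{\Lambda'}$ for $\Lambda\subset\Lambda'$, everywhere). $\gamma_\Lambda(\sigma|\omega)$ denotes the $\gamma_\Lambda(\cdot|\omega)$-probability of $\{\omega':\omega'_\Lambda=\sigma_\Lambda\}$,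 and $\gamma_\Lambda f(\omega)=\int f\,d\gamma_\Lambda(\cdot|\omega)$. All specifications are assumed non-null: for each $\Lambda\in\mathcal S$ there are $0<a_\Lambda<b_\Lambda<1$ with $a_\Lambda<\inf_{\sigma,\eta}\gamma_\Lambda(\sigma|\eta)\le\sup_{\sigma,\eta}\gamma_\Lambda(\sigma|\eta)<b_\Lambda$. $\gamma$ is quasilocal if $\gamma_\Lambda f\in C(\Omega)$ for all $\Lambda\in\mathcal S$ and all local $f$. $\gamma$ is translation invariant if $\gamma_{\Lambda+x}(A|\omega)=\gamma_\Lambda(\tau_xA|\tau_x\omega)$. $\mathcal G(\gamma)$ is the set of probability measures $\mu$ with $\mu[A|\mathcal F_{\Lambda^c}]=\gamma_\Lambda(A|\cdot)$ $\mu$-a.s. for all $A\in\mathcal F,\Lambda\in\mathcal S$; $\mathcal G_{\mathrm{inv}}(\gamma)$ is the set of its translation invariant elements. $h(\mu|\nu)=\lim_{n\to\infty}|\Lambda_n|^{-1}h_{\Lambda_n}(\mu|\nu)$ with $\Lambda_n=[-n,n]^d\cap\mathbb Z^d$ (or a Van Hove sequence), where, with $\mu_\Lambda,\nu_\Lambda$ the marginals on $E^\Lambda$, $h_\Lambda(\mu|\nu)=\int\frac{d\mu_\Lambda}{d\nu_\Lambda}\log\frac{d\mu_\Lambda}{d\nu_\Lambda}\,d\nu$ if $\mu_\Lambda\ll\nu_\Lambda$ and $+\infty$ otherwise. *)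

(* Defs.v *)
From HB Require Import structures.
From mathcomp Require Import all_boot all_order all_algebra finmap.
From mathcomp Require Import all_classical all_reals all_analysis.
From mathcomp Require Import measurable_realfun.
From mathcomp Require Import zify.

Set Implicit Arguments.
Unset Strict Implicit.
Unset Printing Implicit Defensive.

Import Order.TTheory GRing.Theory Num.Theory.
Import numFieldNormedType.Exports.

Local Open Scope classical_set_scope.
Local Open Scope ring_scope.

(* Nonempty finite types: measurable types of the library are pointed. *)
#[short(type="finPointedType")]
HB.structure Definition FinPointed := {T of Finite T & isPointed T}.

(* [config E I] is E^I with E discrete, carrying the product topology and the
   corresponding Borel sigma-field. *)
Definition config (E : finPointedType) (I : Type) : Type := I -> E.

HB.instance Definition _ (E : finPointedType) (I : Type) :=
  Topological.copy (config E I) (prod_topology (fun _ : I => discrete_topology E)).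
HB.instance Definition _ (E : finPointedType) (I : Type) :=
  isPointed.Build (config E I) (fun=> point).
HB.instance Definition _ (E : finPointedType) (I : Type) :=
  Measurable.copy (config E I) (g_sigma_algebraType (@open (config E I))).

Definition restr (E : finPointedType) (I : Type) (P : pred I)
  (w : config E I) : config E {x | P x} := fun x => w (val x).

Lemma coord_continuous (E : finPointedType) (I : Type) (x : I) :
  continuous (fun w : config E I => w x : discrete_topology E).
Proof.
move=> w.
pose f := fun v : I -> discrete_topology E => v x.
pose T := fun i => Topological.class
  (initial_topology (fun v : I -> discrete_topology E => v i)).
have ww : nbhs (w : sup_topology T) --> (w : sup_topology T) by exact: cvg_id.
have wx := (@cvg_sup _ _ T (nbhs (w : sup_topology T)) w _).1 ww x.
move=> A /(@initial_continuous _ _ f w) /wx.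
exact.
Qed.

Lemma restr_continuous (E : finPointedType) (I : Type) (P : pred I) :
  continuous (@restr E I P).
Proof.
move=> w.
pose T := fun i : {x | P x} => Topological.class
  (initial_topology (fun v : {x | P x} -> discrete_topology E => v i)).
apply: (@cvg_sup _ _ T (restr w' @[w' --> w]) (restr w) 
  (fmap_filter _ (nbhs_filter w))).2 => x.
apply: (@continuous_comp_initial _ (config E I) _
  (fun v : {x | P x} -> discrete_topology E => v x)).
exact: (@coord_continuous E I (val x)).
Qed.

Lemma restr_measurable (E : finPointedType) (I : Type) (P : pred I) :
  measurable_fun [set: config E I] (@restr E I P).
Proof.
apply: (@measurability _ _ (config E I) (config E {x | P x}) setT (@restr E I P)
  (@open (config E {x | P x}))) => //.
move=> _ [B oB <-]; rewrite setTI; apply: sub_sigma_algebra.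
by move/continuousP: (@restr_continuous E I P); apply.
Qed.

HB.instance Definition _ (E : finPointedType) (I : Type) (P : pred I) :=
  isMeasurableFun.Build _ _ _ _ (@restr E I P) (@restr_measurable E I P).

Notation site d := 'rV[int]_d.

Section Defs.
Context (R : realType) (d : nat) (E : finPointedType).

Local Notation Omega := (config E (site d)).
Implicit Types (L : {fset site d}) (A B : set Omega) (w s : Omega)
  (mu nu : probability Omega R) (x y : site d).

Definition tau x w : Omega := fun y => w (x + y).

Definition shift_fset x L : {fset site d} := [fset (y + x)%R | y in L]%fset.

(* F_D, the sigma-field generated by the coordinates in D *)
Definition coord_sigma (D : set (site d)) : set (set Omega) :=
  <<s [set B | exists2 x, D x & exists e : E, B = [set w | w x = e]] >>.

Definition measurable_wrt d' (T : measurableType d') (G : set (set Omega))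
  (f : Omega -> T) : Prop := forall C : set T, measurable C -> G (f @^-1` C).

Definition local_fun (f : Omega -> R) : Prop :=
  exists L, measurable_wrt (coord_sigma [set` L]) f.

Definition translation_invariant mu : Prop :=
  forall x A, measurable A -> mu (tau x @^-1` A) = mu A.

Definition kernels : Type :=
  forall L, R.-pker (config E {x | x \notin L}) ~> Omega.

Implicit Types g : kernels.

(* gamma_L( . | w) for w a configuration on the whole lattice *)
Definition ker_at g L w : {measure set Omega -> \bar R} :=
  g L (@restr E _ (fun x => x \notin L) w).

Definition proper_kernels g : Prop :=
  forall L B, coord_sigma [set x | x \notin L] B ->
  forall w, ker_at g L w B = (\1_B w)%:E.

Definition consistent_kernels g : Prop :=
  forall L L', (L `<=` L')%fset -> forall A, measurable A ->
  forall w, (\int[ker_at g L' w]_s ker_at g L s A = ker_at g L' w A)%E.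

Definition specification g : Prop := proper_kernels g /\ consistent_kernels g.

Definition cylinder L s : set Omega := [set w | forall x, x \in L -> w x = s x].

(* The empty set is excluded: gamma_fset0 (s | w) = 1 always. *)
Definition nonnull g : Prop :=
  forall L, L != fset0 -> exists a b : R,
  [/\ 0 < a, a < b, b < 1,
    (a%:E < ereal_inf [set ker_at g L w.2 (cylinder L w.1) | w in [set: Omega * Omega]])%E &
    (ereal_sup [set ker_at g L w.2 (cylinder L w.1) | w in [set: Omega * Omega]] < b%:E)%E].

Definition quasilocal g : Prop :=
  forall L f, local_fun f -> continuous (fun w => \int[ker_at g L w]_s f s : R).

Definition spec_translation_invariant g : Prop :=
  forall x L A, measurable A -> forall w,
  ker_at g (shift_fset x L) w A = ker_at g L (tau x w) (tau x @` A).

(* f is a version of the conditional probability mu[A | G] *)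
Definition is_cond_prob mu (G : set (set Omega)) A (f : Omega -> \bar R) : Prop :=
  measurable_wrt G f /\
  forall B, G B -> (\int[mu]_(w in B) f w = mu (A `&` B))%E.

Definition gibbs g mu : Prop :=
  forall L A, measurable A ->
  is_cond_prob mu (coord_sigma [set x | x \notin L]) A (fun w => ker_at g L w A).

Definition gibbs_inv g mu : Prop := gibbs g mu /\ translation_invariant mu.

Definition marginal mu L : probability (config E {x | x \in L}) R :=
  distribution mu (@restr E _ (fun x => x \in L)).

(* The density is finite everywhere when it exists; the convention 0 log 0 = 0
   is [ln 0 = 0]. *)
Definition rel_entropy L mu nu : \bar R :=
  if `[< marginal mu L `<< marginal nu L >] then
    let f := fun t => fine (Radon_Nikodym
      (charge_of_finite_measure (marginal mu L)) (marginal nu L) t) in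
    (\int[marginal nu L]_t (f t * ln (f t))%:E)%E
  else +oo%E.

Definition cubes : nat -> {fset site d} := fun n =>
  [fset (\row_i ((f i)%:Z - n%:Z))
     | f : {ffun 'I_d -> 'I_(n.*2.+1)} in predT]%fset.

Lemma mem_cubes n x :
  (x \in cubes n) = [forall i, - n%:Z <= x ord0 i <= n%:Z].
Proof.
apply/imfsetP/forallP => [[f _ ->] i|xn].
  rewrite mxE; case: (f i) => k /= kn; apply/andP; split; lia.
have xb i : (absz (x ord0 i + n%:Z)%R < n.*2.+1)%N by have := xn i; lia.
exists [ffun i => Ordinal (xb i)] => //.
apply/rowP => i; rewrite mxE ffunE /= gez0_abs; last by have := xn i; lia.
by rewrite addrK (ord1 ord0).
Qed.

(* The points of L at sup-distance at most r from the complement of L *)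
Definition inner_boundary (r : nat) L : {fset site d} :=
  [fset x in L | `[< exists2 y, y \notin L &
                      forall i, `|y ord0 i - x ord0 i| <= r%:Z >]]%fset.

Definition van_hove (V : nat -> {fset site d}) : Prop :=
  (forall n, V n != fset0) /\
  forall r, (#|` inner_boundary r (V n)|%:R / #|` V n|%:R : R) @[n --> \oo] --> (0 : R).

Definition entropy_density_seq (V : nat -> {fset site d}) mu nu : nat -> \bar R :=
  fun n => ((#|` V n|%:R^-1)%:E * rel_entropy (V n) mu nu)%E.

Definition entropy_density (V : nat -> {fset site d}) mu nu : \bar R :=
  lim (entropy_density_seq V mu nu n @[n --> \oo]).

End Defs.

(* Main.v *)
From HB Require Import structures.
Require Import Defs.
From mathcomp Require Import all_boot all_order all_algebra finmap.
From mathcomp Require Import all_classical all_reals all_analysis.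
From mathcomp Require Import measurable_realfun zify ring lra.
Import Order.TTheory GRing.Theory Num.Theory.
Import numFieldNormedType.Exports.
Set Implicit Arguments.
Unset Strict Implicit.
Unset Printing Implicit Defensive.
Local Open Scope classical_set_scope.
Local Open Scope ring_scope.

(** Entropy and energy both have a limit per site, and the relative entropy is
    made of these two.

    Write [H_V] for the Shannon entropy of a window marginal. Filling [V] in
    lexicographic order, the chain rule writes [H_V] as a sum over sites of the
    entropy of a site given the sites of [V] before it. Conditioning lowers
    entropy ([cond_entropy_mono]), so by translation invariance every term is
    at least the infimum of the entropy of the origin given finitely many of its
    predecessors, and is close to it away from the boundary ([shannon_asymp]).
    As the argument goes site by site, it applies to windows of any shape.

    For a Gibbs measure [nu], the logarithm of the ratio of the probabilities
    of a configuration and of a constant one telescopes along the same order into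
    ratios of probabilities of configurations that differ at one site. By the
    single-site conditional probabilities these are ratios of single-site
    kernels, bounded since the kernels are non-null, and close to a fixed local
    function by quasilocality when the site is far from the boundary
    ([energy_site_energy]). Nothing in this approximation depends on which Gibbs
    measure is considered, only on the specification. The normalization, that
    is the probability of the constant configuration, disappears in

      h_V(mu|nu) = H_V(nu) - H_V(mu) - (mu - nu)(energy of nu in V),

    ([kl_decomp]), which yields the limit ([kl_asymp]) with no study of the
    pressure.

    If [mu] is Gibbs too, the entropies cancel in h_V(mu|nu) + h_V(nu|mu) and the
    difference of two energies of the same specification remains, which is
    negligible against the volume; both summands being nonnegative, each of them
    is negligible ([gibbs_kl_asymp]).

    Conversely, let h(mu|nu) = 0 and let [L] be a finite set. Removing well
    separated translates of [L] one after the other from a large window, each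
    removal lowers the relative entropy; as the number of translates is
    proportional to the volume while the total is not, some removal, in an
    arbitrarily large neighbourhood of [L], lowers it by an arbitrarily small
    amount ([kl_packing], [kl_small_increment]). This decrease is the mean relative
    entropy of the conditional laws of [L] under [mu] and [nu], so these laws are
    close in total variation ([window_spec_tv]); the law under [nu] is close to
    the kernel by quasilocality ([window_spec_near]). Hence [mu] and the kernels
    satisfy the conditional probability equations on cylinders ([window_dlr]), and
    a monotone class argument with properness extends them to all events
    ([gibbs_of_windows]). *)

(** * Cylinders *)

Section Cylinders.
Context (d : nat) (E : finPointedType).
Local Notation Omega := (config E (site d)).
Implicit Types (L : {fset site d}) (s w : Omega) (x : site d).

Lemma coord_open x (e : E) : open [set w : Omega | w x = e].
Proof.
have /continuousP/(_ [set e]) := @Defs.coord_continuous E (site d) x.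
apply. exact: discrete_open.
Qed.

Lemma cylinderE L s : cylinder L s = \bigcap_(x in [set` L]) [set w | w x = s x].
Proof. by apply/seteqP; split=> w /= ws x /ws. Qed.

Lemma cylinder0 s : cylinder fset0 s = setT.
Proof. by apply/seteqP; split. Qed.

Lemma cylinderU L M s : cylinder (L `|` M)%fset s = cylinder L s `&` cylinder M s.
Proof.
apply/seteqP; split=> w /=.
  by move=> ws; split=> x xL; apply: ws; rewrite inE xL ?orbT.
by move=> [wL wM] x; rewrite inE => /orP[/wL|/wM].
Qed.

Lemma cylinder_sub L M s : (L `<=` M)%fset -> cylinder M s `<=` cylinder L s.
Proof. by move=> /fsubsetP LM w ws x /LM /ws. Qed.

Lemma cylinder_eq L s w : cylinder L s w -> cylinder L w = cylinder L s.
Proof. by move=> ws; apply/seteqP; split=> u /= us x xL; rewrite us// ws. Qed.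

Lemma cylinder_open L s : open (cylinder L s).
Proof.
rewrite cylinderE bigcap_fset.
apply: big_ind; [exact: openT|by move=> A B; exact: openI|].
by move=> x _; exact: coord_open.
Qed.

Lemma measurable_cylinder L s : measurable (cylinder L s).
Proof. by apply: sub_sigma_algebra; exact: cylinder_open. Qed.

(** The sets containing a cylinder around [w] form a filter whose images under the
    coordinates converge, so this filter converges in the product topology. *)
Lemma nbhs_cylinder w (A : set Omega) :
  nbhs w A -> exists L, cylinder L w `<=` A.
Proof.
pose T := fun i => Topological.class
  (initial_topology (fun v : site d -> discrete_topology E => v i)).
pose F : set_system Omega := [set B | exists L, cylinder L w `<=` B].
have FF : Filter F.
  split.
  - by exists fset0.
  - move=> P Q [L LP] [M MQ]; exists (L `|` M)%fset; rewrite cylinderU.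
    by move=> v [/LP ? /MQ ?].
  - by move=> P Q PQ [L LP]; exists L; apply: (subset_trans LP).
have : F --> (w : sup_topology T).
  apply/(@cvg_sup _ _ T F w FF) => x.
  move=> B [C [[D oD <-] Cw DB]] /=.
  exists [fset x]%fset => v vw; apply: DB => /=.
  by rewrite /= (vw x) ?inE.
by move=> h /h.
Qed.

Lemma config_compact : compact [set: Omega].
Proof.
have := @tychonoff _ (fun _ : site d => discrete_topology E) (fun=> setT).
have -> : [set f : forall i : site d, discrete_topology E | forall i, [set: E] (f i)] = setT.
  by apply/seteqP; split.
by apply => i; apply: finite_compact; exact: (@finite_finset E setT).
Qed.

End Cylinders.

Section FiniteWindows.
Context (d : nat) (E : finPointedType).
Local Notation Omega := (config E (site d)).
Implicit Types (L : {fset site d}) (s w : Omega) (x : site d).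

Definition window L w : {ffun L -> E} := [ffun y : L => w (val y)].

Definition ext L (f : {ffun L -> E}) : Omega :=
  fun x => if insub x is Some y then f y else point.

Lemma ext_in L (f : {ffun L -> E}) (y : L) : ext f (val y) = f y.
Proof. by rewrite /ext valK. Qed.

Lemma windowK L w : cylinder L (ext (window L w)) w.
Proof. by move=> x xL; rewrite (ext_in _ [` xL]%fset) ffunE. Qed.

Lemma extK L (f : {ffun L -> E}) : window L (ext f) = f.
Proof. by apply/ffunP => y; rewrite ffunE ext_in. Qed.

Lemma window_eq L w s : window L w = window L s <-> cylinder L s w.
Proof.
split=> [/ffunP ws x xL|ws].
  by have := ws [` xL]%fset; rewrite !ffunE.
by apply/ffunP => y; rewrite !ffunE; apply: ws; exact: valP.
Qed.

Lemma cylinder_window L w (f : {ffun L -> E}) :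
  cylinder L (ext f) w <-> window L w = f.
Proof. by rewrite -window_eq extK. Qed.

Lemma cylinderI_empty L M s t : cylinder L s `&` cylinder M t = set0 \/
  exists w, cylinder L s `&` cylinder M t = cylinder (L `|` M)%fset w.
Proof.
have [[w [ws wt]]|h] := pselect (exists w, (cylinder L s `&` cylinder M t) w).
  by right; exists w; rewrite cylinderU (cylinder_eq ws) (cylinder_eq wt).
by left; apply/seteqP; split=> w //= ws; apply: h; exists w.
Qed.

Definition cylinders : set (set Omega) :=
  [set B | B = set0 \/ exists L s, B = cylinder L s].

Lemma cylinders_setI_closed : setI_closed cylinders.
Proof.
move=> A B [->|[L [s ->]]]; first by left; rewrite set0I.
move=> [->|[M [t ->]]]; first by left; rewrite setI0.
by have [->|[w ->]] := cylinderI_empty L M s t; [left|right; exists (L `|` M)%fset, w].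
Qed.

(** An open set is the union of the cylinders it contains, and there are countably
    many cylinders. *)
Lemma measurable_cylinders : @measurable _ Omega = <<s cylinders >>.
Proof.
apply/seteqP; split; last first.
  apply: smallest_sub; first exact: sigma_algebra_measurable.
  move=> _ [->|[L [s ->]]]; [exact: measurable0|exact: measurable_cylinder].
apply: smallest_sub; first exact: smallest_sigma_algebra.
move=> A oA.
pose I := {L : {fset site d} & {ffun L -> E}}.
pose F (i : I) := cylinder (tag i) (ext (tagged i)).
have -> : A = \bigcup_(i in [set i | F i `<=` A]) F i.
  apply/seteqP; split=> [w Aw|w [i iA]]; last exact: iA.
  have [L LA] := nbhs_cylinder (open_nbhs_nbhs (conj oA Aw)).
  exists (Tagged (fun L : {fset site d} => {ffun L -> E}) (window L w)); last exact: windowK.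
  by rewrite /F /= => v vw; apply: LA; rewrite (cylinder_eq (@windowK L w)).
have mF i : <<s cylinders >> (F i).
  by apply: sub_sigma_algebra; right; exists (tag i), (ext (tagged i)).
rewrite bigcup_mkcond.
apply: (@countable_bigcupT_measurable _ (g_sigma_algebraType cylinders) I) => [|i].
  exact: (@countableP ({L : {fset site d} & {ffun L -> E}} : countType)).
by case: ifP => _; [exact: mF|exact: measurable0].
Qed.

(** Uniform continuity on the compact configuration space, where the entourages
    are given by finite windows. *)
Lemma continuous_window (R : realType) (f : Omega -> R) (e : R) :
  continuous f -> 0 < e -> exists D : {fset site d},
  forall w w', cylinder D w w' -> `|f w' - f w| <= e.
Proof.
move=> cf e0.
have /choice[L hL] w : exists L, cylinder L w `<=` [set v | `|f w - f v| < e / 2].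
  apply: nbhs_cylinder; move/cvgrPdist_lt : (cf w); apply; exact: divr_gt0.
have := @config_compact d E; rewrite compact_cover.
move=> /(_ Omega setT (fun w => cylinder (L w) w)) [w _|w _|D' _ cov].
- exact: cylinder_open.
- by exists w.
exists (\bigcup_(v <- D') L v)%fset => w w' ww'.
have [v /= vD wv] := cov w I.
have w'v : cylinder (L v) v w'.
  rewrite -(cylinder_eq wv); apply: cylinder_sub ww'.
  exact: bigfcup_sup.
have h1 := hL _ _ wv; have h2 := hL _ _ w'v; rewrite /= in h1 h2.
rewrite ltr_norml in h1; rewrite ltr_norml in h2.
rewrite ler_norml; lra.
Qed.

End FiniteWindows.

(** * Expectations of local functions *)

Section LocalFunctions.
Context (R : realType) (d : nat) (E : finPointedType).
Local Notation Omega := (config E (site d)).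
Implicit Types (L : {fset site d}) (s w : Omega) (x : site d).
Implicit Types (F G : Omega -> R) (mu nu : probability Omega R).

(** Dependence on the coordinates in [L]; stated pointwise, it passes to
    logarithms and quotients without any measurability argument. *)
Definition dep (T : Type) L (F : Omega -> T) : Prop :=
  forall s w, cylinder L s w -> F w = F s.

Definition Pr mu L s : R := fine (mu (cylinder L s)).

Definition Ex mu F : R := \int[mu]_w F w.

Lemma Pr_EFin mu L s : (Pr mu L s)%:E = mu (cylinder L s).
Proof. by rewrite fineK// fin_num_measure//; exact: measurable_cylinder. Qed.

Lemma Pr_ge0 mu L s : 0 <= Pr mu L s.
Proof. exact: fine_ge0. Qed.

Lemma Pr_le1 mu L s : Pr mu L s <= 1.
Proof.
by rewrite -lee_fin Pr_EFin probability_le1//; exact: measurable_cylinder.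
Qed.

Lemma Pr0 mu s : Pr mu fset0 s = 1.
Proof. by rewrite /Pr cylinder0 probability_setT. Qed.

Lemma Pr_sub mu L M s : (L `<=` M)%fset -> Pr mu M s <= Pr mu L s.
Proof.
move=> LM; rewrite -lee_fin !Pr_EFin le_measure ?inE//.
- exact: measurable_cylinder.
- exact: measurable_cylinder.
- exact: cylinder_sub.
Qed.

Lemma dep_Pr mu L : dep L (Pr mu L).
Proof. by move=> s w sw; rewrite /Pr (cylinder_eq sw). Qed.

Lemma dep_sub T L M (F : Omega -> T) : (L `<=` M)%fset -> dep L F -> dep M F.
Proof. by move=> LM dF s w sw; apply: dF; exact: cylinder_sub sw. Qed.

Lemma dep_comp (T U : Type) L (h : T -> U) (F : Omega -> T) :
  dep L F -> dep L (fun w => h (F w)).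
Proof. by move=> dF s w /dF ->. Qed.

Lemma dep_op (T U W : Type) L (op : T -> U -> W) (F : Omega -> T) (G : Omega -> U) :
  dep L F -> dep L G -> dep L (fun w => op (F w) (G w)).
Proof. by move=> dF dG s w sw; rewrite (dF _ _ sw) (dG _ _ sw). Qed.

Lemma depB L F G : dep L F -> dep L G -> dep L (fun w => F w - G w).
Proof. exact: (@dep_op _ _ _ L (fun a b : R => a - b)). Qed.

Lemma depM L F G : dep L F -> dep L G -> dep L (fun w => F w * G w).
Proof. exact: (@dep_op _ _ _ L (fun a b : R => a * b)). Qed.

Lemma dep_ln L F : dep L F -> dep L (fun w => ln (F w)).
Proof. exact: (@dep_comp _ _ L (@ln R)). Qed.

Lemma dep_lnPr mu L M : (L `<=` M)%fset -> dep M (fun w => ln (Pr mu L w)).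
Proof. by move=> LM; apply: dep_ln; apply: dep_sub LM _; exact: dep_Pr. Qed.

Lemma dep_ind L M s : (L `<=` M)%fset -> dep M (\1_(cylinder L s) : Omega -> R).
Proof.
move=> LM t w tw; rewrite !indicE; congr (_%:R); congr nat_of_bool.
have {}tw := cylinder_sub LM tw.
by apply/idP/idP; rewrite !inE => h x xL; have := h x xL; rewrite (tw _ xL).
Qed.

(** This reduces expectations of local functions to finite sums. *)
Lemma dep_expand L F w : dep L F ->
  F w = \sum_(f : {ffun L -> E}) F (ext f) * \1_(cylinder L (ext f)) w.
Proof.
move=> dF; rewrite (bigD1 (window L w))//= big1 ?addr0 => [|f fw].
  rewrite indicE mem_set ?mulr1; last exact: windowK.
  by apply: dF; exact: windowK.
rewrite indicE memNset ?mulr0// => /cylinder_window wf.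
by rewrite wf eqxx in fw.
Qed.

Lemma integrable_cylinder mu L s : mu.-integrable setT (EFin \o \1_(cylinder L s)).
Proof.
by apply: integrable_indic => //; exact: measurable_cylinder.
Qed.

Lemma Ex_cylinder mu L s : Ex mu \1_(cylinder L s) = Pr mu L s.
Proof.
rewrite /Ex /Rintegral integral_indic ?setIT//; exact: measurable_cylinder.
Qed.

Lemma integrable_dep mu L F : dep L F -> mu.-integrable setT (EFin \o F).
Proof.
move=> dF.
have -> : EFin \o F = (fun w => \sum_(f : {ffun L -> E})
    (F (ext f))%:E * (EFin \o \1_(cylinder L (ext f))) w)%E.
  by apply/funext => w /=; rewrite [in LHS](dep_expand w dF) -sumEFin.
apply: integrable_sum => //= f _; apply: integrableZl => //.
exact: integrable_cylinder.
Qed.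

Lemma Ex_sumE mu L F : dep L F ->
  Ex mu F = \sum_(f : {ffun L -> E}) F (ext f) * Pr mu L (ext f).
Proof.
move=> dF; rewrite /Ex /Rintegral.
under eq_integral do rewrite (dep_expand _ dF) -sumEFin.
rewrite integral_sum//=; last first.
  move=> f.
  apply: (@integrableZl _ _ _ _ _ _ (F (ext f)) (EFin \o \1_(cylinder L (ext f)))) => //.
  exact: integrable_cylinder.
rewrite -sum_fine; last first.
  move=> f _; apply: integrable_fin_num => //.
  apply: (@integrableZl _ _ _ _ _ _ (F (ext f)) (EFin \o \1_(cylinder L (ext f)))) => //.
  exact: integrable_cylinder.
apply: eq_bigr => f _.
rewrite -Ex_cylinder; apply: RintegralZl => //; exact: integrable_cylinder.
Qed.

Lemma Ex_cst mu (c : R) : Ex mu (fun=> c) = c.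
Proof.
rewrite /Ex Rintegral_cst// -[RHS]mulr1; congr (_ * _).
exact: (congr1 fine (probability_setT mu)).
Qed.

Lemma eq_Ex mu F G : F =1 G -> Ex mu F = Ex mu G.
Proof. by move=> FG; apply: eq_Rintegral => w _. Qed.

Lemma ExD mu L F G : dep L F -> dep L G ->
  Ex mu (fun w => F w + G w) = Ex mu F + Ex mu G.
Proof.
move=> dF dG; apply: RintegralD => //; [exact: integrable_dep dF|].
exact: integrable_dep dG.
Qed.

Lemma ExB mu L F G : dep L F -> dep L G ->
  Ex mu (fun w => F w - G w) = Ex mu F - Ex mu G.
Proof.
move=> dF dG; apply: RintegralB => //; [exact: integrable_dep dF|].
exact: integrable_dep dG.
Qed.

Lemma ExZ mu L c F : dep L F -> Ex mu (fun w => c * F w) = c * Ex mu F.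
Proof. by move=> dF; apply: RintegralZl => //; exact: integrable_dep dF. Qed.

(** Only the configurations of positive probability matter, which makes the
    conventions on [ln 0] and division by zero harmless. *)
Lemma Ex_le mu L F G : dep L F -> dep L G ->
  (forall w, 0 < Pr mu L w -> F w <= G w) -> Ex mu F <= Ex mu G.
Proof.
move=> dF dG FG; rewrite (Ex_sumE mu dF) (Ex_sumE mu dG); apply: ler_sum => f _.
have := Pr_ge0 mu L (ext f); rewrite le0r => /predU1P[->|p0].
  by rewrite !mulr0.
by rewrite ler_pM2r// FG.
Qed.

Lemma eq_Ex_supp mu L F G : dep L F -> dep L G ->
  (forall w, 0 < Pr mu L w -> F w = G w) -> Ex mu F = Ex mu G.
Proof.
move=> dF dG FG; apply/eqP; rewrite eq_le; apply/andP.
by split; apply: (@Ex_le _ L) => // w /FG ->.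
Qed.

Lemma Ex_big mu (I : eqType) (r : seq I) L (F : I -> Omega -> R) :
  (forall i, i \in r -> dep L (F i)) ->
  Ex mu (fun w => \sum_(i <- r) F i w) = \sum_(i <- r) Ex mu (F i).
Proof.
elim: r => [|i r ih] dF.
  by rewrite big_nil -[RHS](Ex_cst mu 0); apply: eq_Ex => w; rewrite big_nil.
have dFr j : j \in r -> dep L (F j) by move=> jr; apply: dF; rewrite inE jr orbT.
rewrite big_cons -ih// -(@ExD _ L).
- by apply: eq_Ex => w; rewrite big_cons.
- by apply: dF; rewrite mem_head.
- by move=> s w sw; apply: eq_big_seq => j /dFr dj; exact: dj.
Qed.

End LocalFunctions.

(** * Relative entropy on a finite window *)

Section RealInequalities.
Context (R : realType).
Implicit Types (p q t u : R).

Lemma ln_le_sub1 u : 0 < u -> ln u <= u - 1.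
Proof.
by move=> u0; rewrite -{1}(subrK 1 u) [u - 1 + 1]addrC; apply: le_ln1Dx; lra.
Qed.

(** The inequality [ln u <= u - 1] at [u = q / p]. *)
Lemma mul_lnB_ge p q : 0 <= p -> 0 <= q -> (0 < p -> 0 < q) ->
  p - q <= p * (ln p - ln q).
Proof.
rewrite le0r => /predU1P[->|p0] q0 pq; first by rewrite mul0r; lra.
have {}q0 := pq p0.
have := ln_le_sub1 (divr_gt0 q0 p0); rewrite ln_div// => h.
have : p * (ln q - ln p) <= p * (q / p - 1) by rewrite ler_pM2l.
rewrite [p * (q / p - 1)]mulrBr mulr1 mulrCA divff ?gt_eqF// mulr1 !mulrBr; lra.
Qed.

Lemma expR_le_quad u : `|u| <= 1 / 2 -> expR u <= 1 + u + 2 * u ^+ 2.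
Proof.
rewrite ler_norml => /andP[u1 u2].
have h := @expR_ge1Dx R (- u); rewrite expRN in h.
have e0 := expR_gt0 u.
have : (1 - u) * expR u <= 1 by rewrite -ler_pdivlMr// mul1r.
have h3 : 1 <= (1 - u) * (1 + u + 2 * u ^+ 2).
  have -> : (1 - u) * (1 + u + 2 * u ^+ 2) = 1 + u ^+ 2 * (1 - 2 * u) by ring.
  by rewrite lerDl mulr_ge0 ?sqr_ge0//; lra.
move=> h4; rewrite -(@ler_pM2l _ (1 - u)); [exact: le_trans h4 h3|lra].
Qed.

(** Young's inequality [p * u <= p * ln (p / q) - p + q * expR u] at [u = t] and
    at [u = - t], with a quadratic bound on the exponential. *)
Lemma norm_sub_le_kl p q t : 0 <= p -> 0 <= q -> (0 < p -> 0 < q) ->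
  0 <= t -> t <= 1 / 2 ->
  t * `|p - q| <= p * (ln p - ln q) - p + q + 2 * t ^+ 2 * q.
Proof.
move=> p0 q0 pq t0 t1.
have key u : `|u| <= 1 / 2 -> u * (p - q) <= p * (ln p - ln q) - p + q + 2 * u ^+ 2 * q.
  move=> u1; have hu := expR_le_quad u1.
  move: p0; rewrite le0r => /predU1P[p0|p0].
    rewrite p0 in pq *; rewrite mul0r.
    have : 0 <= (1 + u + 2 * u ^+ 2) * q by rewrite mulr_ge0// (le_trans (expR_ge0 u)).
    lra.
  have {}q0 := pq p0.
  have qe0 : 0 < q * expR u by rewrite mulr_gt0// expR_gt0.
  have := mul_lnB_ge (ltW p0) (ltW qe0) (fun=> qe0).
  rewrite lnM ?posrE ?expR_gt0// expRK.
  have : q * expR u <= q * (1 + u + 2 * u ^+ 2) by rewrite ler_pM2l.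
  lra.
have [pq1|pq1] := leP 0 (p - q).
  by rewrite ger0_norm// key// ger0_norm.
rewrite ltr0_norm// mulrN -mulNr (le_trans (key (- t) _))//.
  by rewrite normrN ger0_norm.
by rewrite sqrrN.
Qed.

End RealInequalities.

Section WindowEntropy.
Context (R : realType) (d : nat) (E : finPointedType).
Local Notation Omega := (config E (site d)).
Implicit Types (L : {fset site d}) (s w : Omega) (x : site d).
Implicit Types (F G : Omega -> R) (mu nu : probability Omega R).

Definition upd s x (e : E) : Omega := fun y => if y == x then e else s y.

Lemma sum_window_fsetU1 x L F : x \notin L -> dep (x |` L)%fset F ->
  \sum_(f : {ffun (x |` L)%fset -> E}) F (ext f) =
  \sum_(f : {ffun L -> E}) \sum_(e : E) F (upd (ext f) x e).
Proof.
move=> xL dF; rewrite pair_big /=.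
pose h (p : {ffun L -> E} * E) := window (x |` L)%fset (upd (ext p.1) x p.2).
rewrite (reindex h) /=; last first.
  apply: onW_bij; exists (fun g => (window L (ext g), ext g x)).
    move=> [f e]; rewrite /h /=; congr pair.
      rewrite -[RHS]extK; apply/window_eq => y yL.
      rewrite -(windowK _) ?inE ?yL ?orbT// /upd.
      by case: eqP => // yx; rewrite -yx yL in xL.
    by rewrite -(windowK _) ?inE ?eqxx// /upd eqxx.
  move=> g; rewrite /h /= -[RHS]extK; apply/window_eq => y.
  rewrite /upd !inE; case: eqP => [-> //|_ /= yL].
  by rewrite -(windowK _).
by apply: eq_bigr => p _; apply/esym/dF; exact: windowK.
Qed.

Lemma sum_Pr_upd mu x L s : x \notin L ->
  \sum_(e : E) Pr mu (x |` L)%fset (upd s x e) = Pr mu L s.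
Proof.
move=> xL; rewrite -Ex_cylinder.
rewrite -(@eq_Ex _ _ _ _ (fun w => \sum_e \1_(cylinder (x |` L)%fset (upd s x e)) w)).
  rewrite (@Ex_big _ _ _ _ _ _ (x |` L)%fset); last by move=> e _; exact: dep_ind.
  by apply: eq_bigr => e _; rewrite Ex_cylinder.
have updE w e : cylinder (x |` L)%fset (upd s x e) w <-> w x = e /\ cylinder L s w.
  split=> [h|[<- h] y].
    split; first by rewrite h ?inE ?eqxx// /upd eqxx.
    move=> y yL; rewrite h ?inE ?yL ?orbT// /upd; case: eqP => // yx.
    by rewrite -yx yL in xL.
  by rewrite /upd !inE; case: eqP => [-> //|_ /= /h].
move=> w; rewrite (bigD1 (w x))//= big1 ?addr0 => [|e ew].
  by rewrite !indicE; congr (_%:R); congr nat_of_bool;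
     apply/idP/idP; rewrite !inE => h; [case/updE : h|apply/updE].
by rewrite indicE memNset// => /updE[we]; rewrite we eqxx in ew.
Qed.

Lemma sum_Pr mu L : \sum_(f : {ffun L -> E}) Pr mu L (ext f) = 1.
Proof.
rewrite -[RHS](Ex_cst mu 1) (@Ex_sumE _ _ _ _ L)//.
by apply: eq_bigr => f _; rewrite mul1r.
Qed.

(** The convention [ln 0 = 0] makes this a real number; it is the relative entropy
    of the marginals when [nu] charges every cylinder. *)
Definition kl mu nu L : R := Ex mu (fun w => ln (Pr mu L w) - ln (Pr nu L w)).

(** Gibbs' inequality, summed from [mul_lnB_ge]. *)
Lemma Ex_lnB_ge mu L (q : Omega -> R) : dep L q -> (forall s, 0 <= q s) ->
  (forall s, 0 < Pr mu L s -> 0 < q s) ->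
  1 - \sum_(f : {ffun L -> E}) q (ext f) <= Ex mu (fun w => ln (Pr mu L w) - ln (q w)).
Proof.
move=> dq q0 pq; rewrite (@Ex_sumE _ _ _ _ L); last first.
  by apply: depB; [exact: dep_lnPr|exact: dep_ln].
rewrite -(sum_Pr mu L) -sumrB; apply: ler_sum => f _.
by rewrite [leRHS]mulrC; apply: mul_lnB_ge; [exact: Pr_ge0|exact: q0|exact: pq].
Qed.

Lemma kl_ge0 mu nu L : (forall s, 0 < Pr nu L s) -> 0 <= kl mu nu L.
Proof.
move=> nu0; apply: le_trans (Ex_lnB_ge (@dep_Pr _ _ _ nu L) _ _) => //.
  by rewrite sum_Pr subrr.
by move=> s; exact: Pr_ge0.
Qed.

(** A Pinsker-type inequality, linearized in [t] so that it can be summed term by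
    term; optimizing [t] bounds the total variation by the square root of the
    relative entropy. *)
Lemma total_variation_le_kl mu L (q : Omega -> R) t : dep L q ->
  (forall s, 0 <= q s) ->
  (forall s, 0 < Pr mu L s -> 0 < q s) ->
  \sum_(f : {ffun L -> E}) q (ext f) = 1 -> 0 <= t -> t <= 1 / 2 ->
  t * \sum_(f : {ffun L -> E}) `|Pr mu L (ext f) - q (ext f)| <=
  Ex mu (fun w => ln (Pr mu L w) - ln (q w)) + 2 * t ^+ 2.
Proof.
move=> dq q0 pq q1 t0 t1; rewrite (@Ex_sumE _ _ _ _ L); last first.
  by apply: depB; [exact: dep_lnPr|exact: dep_ln].
have -> : 2 * t ^+ 2 = \sum_(f : {ffun L -> E})
    (- Pr mu L (ext f) + q (ext f) + 2 * t ^+ 2 * q (ext f)).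
  by rewrite !big_split /= sumrN sum_Pr q1 -mulr_sumr q1 mulr1 addNr add0r.
rewrite mulr_sumr -big_split /=; apply: ler_sum => f _.
have := norm_sub_le_kl (Pr_ge0 mu L (ext f)) (q0 (ext f)) (pq _) t0 t1.
lra.
Qed.

End WindowEntropy.

(** * The lexicographic order on the lattice *)

Section Lexicographic.
Context (d : nat).
Implicit Types (x y z v : site d) (V W : {fset site d}).

(** First nonzero coordinate negative: defining the order through a cone of
    negative vectors makes it translation invariant. *)
Definition lexneg v : bool :=
  [exists i : 'I_d, (v ord0 i < 0) && [forall j : 'I_d, (j < i)%N ==> (v ord0 j == 0)]].

Definition prec x y : bool := lexneg (x - y).

Lemma lexnegP v : reflect
  (exists2 i : 'I_d, v ord0 i < 0 & forall j : 'I_d, (j < i)%N -> v ord0 j = 0) (lexneg v).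
Proof.
apply: (iffP existsP) => [[i /andP[vi /forallP vj]]|[i vi vj]]; exists i => //.
  by move=> j ji; apply/eqP; move/implyP: (vj j); apply.
by rewrite vi; apply/forallP => j; apply/implyP => /vj ->.
Qed.

Lemma lexneg0 : lexneg 0 = false.
Proof. by apply/lexnegP => -[i]; rewrite mxE ltxx. Qed.

Lemma lexnegD u v : lexneg u -> lexneg v -> lexneg (u + v).
Proof.
move=> /lexnegP[i ui uj] /lexnegP[k vk vj]; apply/lexnegP.
have [ik|ki|ik] := ltngtP i k.
- exists i => [|j ji]; first by rewrite mxE (vj _ ik) addr0.
  by rewrite mxE uj// vj ?addr0// (ltn_trans ji).
- exists k => [|j jk]; first by rewrite mxE (uj _ ki) add0r.
  by rewrite mxE uj ?vj ?addr0// (ltn_trans jk).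
- have {}ik : i = k by exact: val_inj.
  subst k; exists i => [|j ji]; first by rewrite mxE -[0]addr0 ltrD.
  by rewrite mxE uj ?vj ?addr0.
Qed.

Lemma lexneg_total v : v != 0 -> lexneg v || lexneg (- v).
Proof.
move=> v0.
have [i0 vi0] : exists i, v ord0 i != 0.
  apply/existsP; apply: contraNT v0; rewrite negb_exists => /forallP h.
  by apply/eqP/rowP => i; rewrite mxE; apply/eqP; rewrite -[_ == _]negbK.
have [i vi imin] := @arg_minnP _ i0 (fun i => v ord0 i != 0) (@nat_of_ord d) vi0.
have vj (j : 'I_d) : (j < i)%N -> v ord0 j = 0.
  by move=> ji; apply/eqP; apply: contraLR ji => /imin; rewrite -leqNgt.
have [vi1|vi1|vi1] := ltgtP (v ord0 i) 0.
- by apply/orP; left; apply/lexnegP; exists i.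
- apply/orP; right; apply/lexnegP; exists i; first by rewrite mxE oppr_lt0.
  by move=> j ji; rewrite mxE vj// oppr0.
- by rewrite vi1 eqxx in vi.
Qed.

Lemma precxx x : prec x x = false.
Proof. by rewrite /prec subrr lexneg0. Qed.

Lemma prec_trans y x z : prec x y -> prec y z -> prec x z.
Proof. by move=> xy yz; have := lexnegD xy yz; rewrite /prec addrA subrK. Qed.

Lemma prec_asym x y : prec x y -> prec y x = false.
Proof.
move=> xy; apply: contraTF xy => yx; apply/negP => xy.
by have := prec_trans xy yx; rewrite precxx.
Qed.

Lemma prec_total x y : x != y -> prec x y || prec y x.
Proof. by rewrite -subr_eq0 => /lexneg_total; rewrite opprB. Qed.

Lemma precDl z x y : prec (z + x) (z + y) = prec x y.
Proof. by rewrite /prec opprD addrACA subrr add0r. Qed.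

Lemma exists_prec_max V : V != fset0 ->
  exists2 m, m \in V & forall y, y \in V -> y != m -> prec y m.
Proof.
have [n] := ubnP #|` V|; elim: n V => // n ih V Vn /fset0Pn[x xV].
have [V0|/ih] := eqVneq (V `\ x)%fset fset0.
  exists x => // y yV yx; have : y \in (V `\ x)%fset by rewrite !inE yx.
  by rewrite V0.
rewrite (cardfsD1 x) xV in Vn => -[//|m]; rewrite !inE => /andP[mx mV] hm.
have /orP[] := prec_total mx => mx1.
  exists x => // y yV yx; have [->//|ym] := eqVneq y m.
  by apply: prec_trans mx1; apply: hm => //; rewrite !inE yx.
exists m => // y yV ym; have [->//|yx] := eqVneq y x.
by apply: hm => //; rewrite !inE yx.
Qed.

Definition before V x : {fset site d} := [fset y in V | prec y x]%fset.

Lemma mem_before V x y : (y \in before V x) = (y \in V) && prec y x.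
Proof. by rewrite !inE. Qed.

Lemma before_notin V x : x \notin before V x.
Proof. by rewrite mem_before precxx andbF. Qed.

(** Applied to the entropy it is the chain rule; applied to the log-probability
    of a configuration erased outside a growing set it interpolates between two
    configurations. *)
Lemma telescope_before (M : zmodType) (F : {fset site d} -> M) V :
  F V - F fset0 =
  \sum_(x <- V) (F (x |` before V x)%fset - F (before V x)).
Proof.
have [n] := ubnP #|` V|; elim: n V => // n ih V Vn.
have [->|/exists_prec_max[m mV hm]] := eqVneq V fset0.
  by rewrite big_seq_fset0 subrr.
have Vm : before V m = (V `\ m)%fset.
  apply/fsetP => y; rewrite mem_before !inE.
  have [->|ym] := eqVneq y m; first by rewrite precxx andbF.
  by case yV : (y \in V) => //=; rewrite hm.
rewrite (big_fsetD1 m)//= Vm fsetD1K//.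
rewrite (cardfsD1 m) mV in Vn.
rewrite [in RHS](eq_big_seq
  (fun x => F (x |` before (V `\ m) x)%fset - F (before (V `\ m)%fset x))).
  by rewrite -ih// addrA subrK.
move=> x; rewrite !inE => /andP[xm xV].
suff -> : before V x = before (V `\ m)%fset x by [].
apply/fsetP => y; rewrite !mem_before !inE.
have [->|//] := eqVneq y m.
by rewrite (prec_asym (hm _ xV xm)) andbF.
Qed.

End Lexicographic.

(** * Averages along van Hove sequences *)

Section VanHove.
Context (R : realType) (d : nat).
Implicit Types (x y z : site d) (D V W : {fset site d}).

(** A suitable [r] is the largest norm of a site of [D]. *)
Lemma bulk_window D : exists r, forall V x, x \in V -> x \notin inner_boundary r V ->
  forall z, z \in D -> x + z \in V.
Proof.
exists (\max_(z <- D) \max_(i < d) `|z ord0 i|%N) => V x xV; rewrite !inE xV /=.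
move=> /asboolPn h z zD; apply: contrapT => /negP xz; apply: h.
exists (x + z) => // i; rewrite !mxE [x _ _ + _]addrC addrK -abszE lez_nat.
apply: leq_trans (leq_bigmax_seq z zD _); last by [].
exact: leq_bigmax.
Qed.

Lemma inner_boundary_sub r V : (inner_boundary r V `<=` V)%fset.
Proof. by apply/fsubsetP => x; rewrite !inE => /andP[]. Qed.

Lemma inner_boundary_le r r' V : (r <= r')%N ->
  (inner_boundary r V `<=` inner_boundary r' V)%fset.
Proof.
move=> rr; apply/fsubsetP => x; rewrite !inE => /andP[-> /asboolP[y yV h]] /=.
by apply/asboolP; exists y => // i; apply: le_trans (h i) _; rewrite lez_nat.
Qed.

(** The constants [r] and [C] do not depend on [V], so that dividing by the volume
    along a van Hove sequence only leaves the error [e]. This error is kept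
    because energies are only approximated by local functions, whose mean [l]
    depends on the approximation. *)
Definition volume_asymp (A : {fset site d} -> R) (l e : R) : Prop :=
  exists r C, 0 <= C /\ forall V,
    `|A V - #|` V|%:R * l| <= e * #|` V|%:R + C * #|` inner_boundary r V|%:R.

Lemma volume_asympB A B l m e f : volume_asymp A l e -> volume_asymp B m f ->
  volume_asymp (fun V => A V - B V) (l - m) (e + f).
Proof.
move=> [r [C [C0 hA]]] [r' [C' [C'0 hB]]].
exists (maxn r r'), (C + C'); split=> [|V]; first exact: addr_ge0.
have mono k : (k <= maxn r r')%N ->
    (#|` inner_boundary k V|%:R : R) <= #|` inner_boundary (maxn r r') V|%:R.
  by move=> /(inner_boundary_le V)/fsubset_leq_card; rewrite ler_nat.
have h1 := ler_wpM2l C0 (mono r (leq_maxl _ _)).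
have h2 := ler_wpM2l C'0 (mono r' (leq_maxr _ _)).
have -> : A V - B V - #|` V|%:R * (l - m) =
  (A V - #|` V|%:R * l) - (B V - #|` V|%:R * m) by ring.
apply: le_trans (ler_normB _ _) _; have := hA V; have := hB V; lra.
Qed.

Lemma sum_boundary_le D : exists r, forall V (a : site d -> R) e C,
  (forall x, x \in V -> (forall z, z \in D -> x + z \in V) -> `|a x| <= e) ->
  (forall x, x \in V -> `|a x| <= C) -> 0 <= e ->
  `|\sum_(x <- V) a x| <= e * #|` V|%:R + C * #|` inner_boundary r V|%:R.
Proof.
have [r hr] := bulk_window D.
exists r => V a e C ha hC e0; apply: le_trans (ler_norm_sum _ _ _) _.
have -> : e * #|` V|%:R + C * #|` inner_boundary r V|%:R =
  \sum_(x <- V) (e + (if x \in inner_boundary r V then C else 0)).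
  rewrite big_split /= big_const_seq count_predT iter_addr addr0 mulr_natr; congr +%R.
  rewrite -big_mkcond -big_filter big_const_seq count_predT iter_addr addr0 mulr_natr.
  congr (_ *+ _); apply: perm_size; apply: uniq_perm.
  - exact: fset_uniq.
  - by rewrite filter_uniq// fset_uniq.
  - move=> x; rewrite mem_filter; case xb : (x \in inner_boundary r V) => //=.
    by rewrite (fsubsetP (inner_boundary_sub r V)).
rewrite big_seq [leRHS]big_seq; apply: ler_sum => x xV.
case: ifPn => xb; first by rewrite ler_wpDl// hC.
by rewrite addr0 ha//; exact: hr.
Qed.

Lemma volume_asymp_sum (a : {fset site d} -> site d -> R) D l e C :
  (forall V x, x \in V -> (forall z, z \in D -> x + z \in V) -> `|a V x - l| <= e) ->
  (forall V x, x \in V -> `|a V x - l| <= C) ->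
  0 <= e -> 0 <= C ->
  volume_asymp (fun V => \sum_(x <- V) a V x) l e.
Proof.
move=> ha hC e0 C0; have [r hr] := sum_boundary_le D.
exists r, C; split=> // V.
have -> : \sum_(x <- V) a V x - #|` V|%:R * l = \sum_(x <- V) (a V x - l).
  by rewrite sumrB big_const_seq count_predT iter_addr addr0 mulr_natl.
by apply: hr => // x xV; [exact: ha|exact: hC].
Qed.

Section Sequences.
Context (V : nat -> {fset site d}) (VV : van_hove R V).

Lemma volume_asymp_near A l e e' : volume_asymp A l e -> e < e' ->
  \forall n \near \oo, `|#|` V n|%:R^-1 * A (V n) - l| <= e'.
Proof.
move=> [r [C [C0 h]]] ee'.
have [V0 /(_ r)] := VV.
move=> /cvgrPdist_lt /(_ ((e' - e) / (C + 1))) hr.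
have : 0 < (e' - e) / (C + 1) by rewrite divr_gt0//; lra.
move=> /hr; apply: filterS => n; rewrite sub0r normrN => hn.
have c0 : 0 < #|` V n|%:R :> R by rewrite ltr0n cardfs_gt0.
rewrite -(ler_pM2l c0) -{1}(gtr0_norm c0) -normrM mulrBr mulrA divff ?gt_eqF// mul1r.
apply: le_trans (h _) _.
rewrite ger0_norm in hn; last by rewrite divr_ge0.
move: hn; rewrite ltr_pdivrMr// mulrAC ltr_pdivlMr; last by lra.
have : 0 <= #|` inner_boundary r (V n)|%:R :> R by [].
nra.
Qed.

(** The approximate rates make the sequence of averages a Cauchy sequence. *)
Lemma volume_asymp_cvg A : (forall e, 0 < e -> exists l, volume_asymp A l e) ->
  exists h : R, #|` V n|%:R^-1 * A (V n) @[n --> \oo] --> h.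
Proof.
move=> h; apply/cvg_ex; apply: cauchy_cvg; apply/cauchy_exP => e e0.
have e4 : 0 < e / 4 by rewrite divr_gt0.
have [l hl] := h _ e4.
exists l; have := volume_asymp_near hl (_ : e / 4 < e / 2).
have e24 : e / 4 < e / 2 by lra.
move=> /(_ e24); apply: filterS => n hn; rewrite /ball /= distrC.
by apply: le_lt_trans hn _; lra.
Qed.

End Sequences.

End VanHove.

Section Cubes.
Context (R : realType) (d : nat).

Lemma card_cubes n : #|` cubes d n| = (n.*2.+1 ^ d)%N.
Proof.
rewrite /cubes card_imfset /=; last first.
  move=> f g /rowP fg; apply/ffunP => i; apply: val_inj; have := fg i.
  by rewrite !mxE => /addIr[].
rewrite -cardE (eq_card (B := {ffun 'I_d -> 'I_(n.*2.+1)}))//.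
by rewrite card_ffun !card_ord.
Qed.

Lemma inner_boundary_cubes r n : (r <= n)%N ->
  (inner_boundary r (cubes d n) `<=` cubes d n `\` cubes d (n - r)%N)%fset.
Proof.
move=> rn; apply/fsubsetP => x; rewrite !inE => /andP[xn /asboolP[y yn h]].
rewrite xn andbT; apply: contra yn; rewrite !mem_cubes => /forallP hx.
apply/forallP => i; move: (hx i) (h i); rewrite ler_norml.
by move: (x ord0 i) (y ord0 i) => a b; lia.
Qed.

Lemma cubes_sub m n : (m <= n)%N -> (cubes d m `<=` cubes d n)%fset.
Proof.
move=> mn; apply/fsubsetP => x; rewrite !mem_cubes => /forallP hx.
by apply/forallP => i; move: (hx i); move: (x ord0 i) => a; lia.
Qed.

(** Bernoulli's inequality bounds the volume lost when shrinking the side of a cube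
    by the factor [1 - u]. *)
Lemma bernoulli_le (u : R) k : 0 <= u -> u <= 1 -> 1 - (1 - u) ^+ k <= k%:R * u.
Proof.
move=> u0 u1; elim: k => [|k ih]; first by rewrite expr0 subrr mul0r.
have h : (1 - u) ^+ k <= 1 by rewrite exprn_ile1//; lra.
have h0 : 0 <= (1 - u) ^+ k by rewrite exprn_ge0//; lra.
rewrite exprS -natr1; nra.
Qed.

Lemma van_hove_cubes : van_hove R (cubes d).
Proof.
split=> [n|r].
  by rewrite -cardfs_gt0 card_cubes expn_gt0.
apply/cvgrPdist_le => e e0.
pose c : R := (d * r.*2)%:R.
have ec0 : 0 < e / (c + 1) by rewrite divr_gt0// ltr_wpDl.
near=> n.
have rn : (r <= n)%N by near: n; exists r.
rewrite sub0r normrN ger0_norm ?divr_ge0//.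
have : (n.+1%:R^-1 : R) < e / (c + 1).
  by near: n; exact: (near_infty_natSinv_lt (PosNum ec0)).
have n0 : 0 < (n.*2.+1)%:R :> R by [].
have nd0 : 0 < (n.*2.+1)%:R ^+ d :> R by rewrite exprn_gt0.
pose u : R := r.*2%:R / n.*2.+1%:R.
have u0 : 0 <= u by rewrite divr_ge0.
have u1 : u <= 1.
  by rewrite ler_pdivrMr// mul1r ler_nat ltnW// ltnS leq_double.
have hb : (#|` inner_boundary r (cubes d n)|%:R : R) <=
    (n.*2.+1)%:R ^+ d - ((n - r).*2.+1)%:R ^+ d.
  rewrite lerBrDr -!natrX -natrD ler_nat -!card_cubes.
  have := fsubset_leq_card (inner_boundary_cubes rn).
  have h := cubes_sub (leq_subr r n).
  rewrite cardfsD (fsetIidPr h).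
  have := fsubset_leq_card h; lia.
have uE : (n.*2.+1)%:R * (1 - u) = ((n - r).*2.+1)%:R :> R.
  rewrite mulrBr mulr1 /u mulrCA divff ?gt_eqF// mulr1 -natrB; last by lia.
  by congr (_%:R); lia.
have := bernoulli_le d u0 u1.
rewrite card_cubes natrX ler_pdivrMr// => hbern.
move=> hn; apply: le_trans hb _; rewrite -uE exprMn.
have : 1 - (1 - u) ^+ d <= e.
  apply: le_trans hbern _.
  have : u <= r.*2%:R * n.+1%:R^-1.
    rewrite /u ler_wpM2l// lef_pV2 ?posrE// ler_nat; lia.
  have c0 : 0 <= c by [].
  have : c * n.+1%:R^-1 <= c * (e / (c + 1)) by rewrite ler_wpM2l// ltW.
  have : c * (e / (c + 1)) <= e.
    by rewrite mulrCA ler_piMr ?(ltW e0)// ler_pdivrMr; lra.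
  move=> h1 h2 h3; apply: le_trans (le_trans h2 h1).
  by rewrite /c natrM -mulrA ler_wpM2l.
by move=> h; rewrite -[X in X - _]mulr1 -mulrBr [leRHS]mulrC ler_pM2l.
Unshelve. all: end_near.
Qed.

End Cubes.

(** * Translations *)

Section Translations.
Context (R : realType) (d : nat) (E : finPointedType).
Local Notation Omega := (config E (site d)).
Implicit Types (L : {fset site d}) (s w : Omega) (x : site d).
Implicit Types (F G : Omega -> R) (mu nu : probability Omega R).

Lemma in_shift_fset x L y : (y \in shift_fset x L) = (y - x \in L).
Proof.
apply/imfsetP/idP => [[z zL ->]|yL]; first by rewrite addrK.
by exists (y - x) => //; rewrite subrK.
Qed.

Lemma shift_fsetK x L : shift_fset (- x) (shift_fset x L) = L.
Proof. by apply/fsetP => y; rewrite !in_shift_fset opprK addrK. Qed.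

Lemma shift_fset1 x y : shift_fset x [fset y]%fset = [fset (y + x)%R]%fset.
Proof. by apply/fsetP => z; rewrite in_shift_fset !inE subr_eq. Qed.

Lemma shift_fsetU x L M :
  shift_fset x (L `|` M)%fset = (shift_fset x L `|` shift_fset x M)%fset.
Proof. by apply/fsetP => z; rewrite !(in_shift_fset, inE). Qed.

Lemma shift_fsetD x L M :
  shift_fset x (L `\` M)%fset = (shift_fset x L `\` shift_fset x M)%fset.
Proof. by apply/fsetP => z; rewrite !(in_shift_fset, inE). Qed.

Lemma tauNK x : cancel (tau (- x)) (tau x : Omega -> Omega).
Proof. by move=> w; apply/funext => y; rewrite /tau addKr. Qed.

Lemma cylinder_shift x L s w :
  cylinder (shift_fset x L) s w <-> cylinder L (tau x s) (tau x w).
Proof.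
split=> h y; last first.
  by rewrite in_shift_fset => /h; rewrite /tau addrCA subrr addr0.
by move=> yL; apply: h; rewrite in_shift_fset addrC addKr.
Qed.

Lemma Pr_shift mu x L s : translation_invariant mu ->
  Pr mu (shift_fset x L) s = Pr mu L (tau x s).
Proof.
move=> tmu; rewrite /Pr -[X in _ = fine X](tmu x); last exact: measurable_cylinder.
congr (fine (mu _)); apply/seteqP; split=> w.
  exact: (cylinder_shift x L s w).1.
exact: (cylinder_shift x L s w).2.
Qed.

Lemma dep_shift T x L (F : Omega -> T) : dep L F -> dep (shift_fset x L) (F \o tau x).
Proof. by move=> dF s w /(cylinder_shift x L s w).1; apply: dF. Qed.

(** On indicators of cylinders this is the invariance of the measure. *)
Lemma Ex_shift mu x L F : translation_invariant mu -> dep L F ->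
  Ex mu (F \o tau x) = Ex mu F.
Proof.
move=> tmu dF.
pose h (f : {ffun L -> E}) : Omega -> R := \1_(cylinder L (ext f)).
have hE f : h f \o tau x = \1_(cylinder (shift_fset x L) (tau (- x) (ext f))).
  apply/funext => w; rewrite /h /= !indicE; congr (_%:R); congr nat_of_bool.
  apply/idP/idP; rewrite !inE => hw; first by apply/cylinder_shift; rewrite tauNK.
  by move/cylinder_shift : hw; rewrite tauNK.
rewrite (@eq_Ex _ _ _ _ (F \o tau x) (fun w => \sum_(f : {ffun L -> E})
  F (ext f) * h f (tau x w))); last by move=> w; exact: (dep_expand (tau x w) dF).
have dh f : dep (shift_fset x L) (fun w => h f (tau x w)).
  by apply: dep_shift; exact: dep_ind.
rewrite (Ex_sumE mu dF) (@Ex_big _ _ _ _ _ _ (shift_fset x L)); last first.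
  by move=> f _; exact: depM.
apply: eq_bigr => f _; rewrite (ExZ _ _ (dh f)); congr (_ * _).
by rewrite -[fun w => _]/(h f \o tau x) hE Ex_cylinder Pr_shift// tauNK.
Qed.

Lemma kl_shift mu nu x L : translation_invariant mu -> translation_invariant nu ->
  kl mu nu (shift_fset x L) = kl mu nu L.
Proof.
move=> tmu tnu; rewrite /kl -[RHS](@Ex_shift _ x L)//.
  by apply: eq_Ex => w; rewrite /= !Pr_shift.
by apply: depB; exact: dep_lnPr.
Qed.

End Translations.

(** * Shannon entropy per site *)

Section Shannon.
Context (R : realType) (d : nat) (E : finPointedType).
Local Notation Omega := (config E (site d)).
Implicit Types (A B L V : {fset site d}) (s w : Omega) (x y : site d).
Context (mu : probability Omega R).

Definition shannon L : R := - Ex mu (fun w => ln (Pr mu L w)).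

Definition cond_entropy x A : R := shannon (x |` A)%fset - shannon A.

Lemma shannon0 : shannon fset0 = 0.
Proof.
rewrite /shannon -[RHS]oppr0 -(Ex_cst mu 0); congr (- _).
by apply: eq_Ex => w; rewrite Pr0 ln1.
Qed.

Lemma cond_entropyE x A B : (x |` A `<=` B)%fset ->
  cond_entropy x A = Ex mu (fun w => ln (Pr mu A w) - ln (Pr mu (x |` A)%fset w)).
Proof.
move=> xAB; rewrite (@ExB _ _ _ _ B); [|apply: dep_lnPr..].
- by rewrite /cond_entropy /shannon opprK addrC.
- exact: fsubset_trans (fsubsetU1 _ _) xAB.
- exact: xAB.
Qed.

Lemma cond_entropy_ge0 x A : 0 <= cond_entropy x A.
Proof.
rewrite (cond_entropyE (fsubset_refl _)) -(Ex_cst mu 0).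
apply: (@Ex_le _ _ _ _ (x |` A)%fset) => //.
  by apply: depB; apply: dep_lnPr => //; exact: fsubsetU1.
move=> w w0; have le := Pr_sub mu w (fsubsetU1 x A).
by rewrite subr_ge0 ler_ln// posrE (lt_le_trans w0).
Qed.

(** Conditioning on more sites lowers the entropy: the relative entropy of the
    true law of the window [x |` B] with respect to the law making [x] and [B]
    conditionally independent given [A] is nonnegative. *)
Lemma cond_entropy_mono x A B : (A `<=` B)%fset -> x \notin B ->
  cond_entropy x B <= cond_entropy x A.
Proof.
move=> AB xB.
have xA : x \notin A by apply: contra xB; exact: (fsubsetP AB).
have xAB : (x |` A `<=` x |` B)%fset by exact: fsetUS.
have AxB : (A `<=` x |` B)%fset := fsubset_trans AB (fsubsetU1 _ _).
have BxB : (B `<=` x |` B)%fset := fsubsetU1 _ _.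
pose q w := Pr mu B w * Pr mu (x |` A)%fset w / Pr mu A w.
have depP L : (L `<=` x |` B)%fset -> dep (x |` B)%fset (Pr mu L).
  by move=> h; apply: dep_sub h _; exact: dep_Pr.
have dq : dep (x |` B)%fset q.
  by apply: depM; [apply: depM; apply: depP => //|
    apply: (@dep_comp _ _ _ _ _ (fun u : R => u^-1)); exact: depP].
have pos L w : (L `<=` x |` B)%fset -> 0 < Pr mu (x |` B)%fset w -> 0 < Pr mu L w.
  by move=> h w0; apply: lt_le_trans w0 _; exact: Pr_sub.
have q_ge0 w : 0 <= q w by rewrite divr_ge0 ?mulr_ge0 ?Pr_ge0.
have q_gt0 w : 0 < Pr mu (x |` B)%fset w -> 0 < q w.
  by move=> w0; rewrite divr_gt0 ?mulr_gt0 ?(pos _ w _ w0).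
have := Ex_lnB_ge dq q_ge0 q_gt0.
have -> : \sum_(f : {ffun (x |` B)%fset -> E}) q (ext f) = 1.
  rewrite (sum_window_fsetU1 xB dq) -[RHS](sum_Pr mu B); apply: eq_bigr => f _.
  have out L e : x \notin L -> Pr mu L (upd (ext f) x e) = Pr mu L (ext f).
    move=> xL; apply: dep_Pr => y yL; rewrite /upd.
    by case: eqP => // yx; rewrite -yx yL in xL.
  under eq_bigr do rewrite /q (out B)// (out A)//.
  rewrite -mulr_suml -mulr_sumr sum_Pr_upd//.
  have [A0|A0] := eqVneq (Pr mu A (ext f)) 0; last by rewrite mulfK.
  rewrite A0 mulr0 mul0r; apply/eqP; rewrite eq_le Pr_ge0 /= -A0.
  exact: Pr_sub.
rewrite subrr => h; rewrite -subr_ge0; apply: le_trans h _.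
rewrite (@cond_entropyE x B _ (fsubset_refl _)) (cond_entropyE xAB).
rewrite -(@ExB _ _ _ _ (x |` B)%fset).
- apply: (@Ex_le _ _ _ _ (x |` B)%fset).
  + by apply: depB; [exact: dep_lnPr|exact: dep_ln].
  + by apply: depB; apply: depB; apply: dep_lnPr.
  move=> w w0; rewrite /q ln_div ?lnM ?posrE ?mulr_gt0 ?(pos _ w _ w0)//.
  lra.
- by apply: depB; apply: dep_lnPr.
- by apply: depB; apply: dep_lnPr.
Qed.

Lemma shannon_shift x L : translation_invariant mu ->
  shannon (shift_fset x L) = shannon L.
Proof.
move=> tmu; rewrite /shannon -[in RHS](@Ex_shift _ _ _ _ x L)//; last exact: dep_lnPr.
by congr (- _); apply: eq_Ex => w; rewrite /= Pr_shift.
Qed.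

Lemma cond_entropy_shift x y A : translation_invariant mu ->
  cond_entropy (x + y) (shift_fset y A) = cond_entropy x A.
Proof.
move=> tmu; rewrite /cond_entropy -shift_fset1 -shift_fsetU.
by rewrite !shannon_shift.
Qed.

(** The rate is the infimum of the entropy of the origin conditioned on finitely
    many preceding sites: the chain rule bounds the entropy per site from below
    by it for every window, and from above up to a boundary term. *)
Lemma shannon_asymp : translation_invariant mu ->
  exists h : R, forall e, 0 < e -> volume_asymp shannon h e.
Proof.
move=> tmu.
pose past (A : {fset site d}) := forall y, y \in A -> prec y 0.
pose S : set R := [set cond_entropy 0 A | A in past].
have S0 : S !=set0 by exists (cond_entropy 0 fset0), fset0.
have lbS : lbound S 0 by move=> _ [A _ <-]; exact: cond_entropy_ge0.
have infS : has_inf S by split=> //; exists 0.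
exists (inf S) => e e0.
have [_ [D pD <-] hD] := inf_adherent e0 infS.
have inf0 : 0 <= inf S by apply: lb_le_inf.
have toorigin x A : cond_entropy x A = cond_entropy 0 (shift_fset (- x) A).
  by rewrite -(@cond_entropy_shift x (- x) A tmu) subrr.
have lower V x : inf S <= cond_entropy x (before V x).
  apply: ge_inf; [by exists 0|rewrite toorigin].
  exists (shift_fset (- x) (before V x)) => // y.
  by rewrite in_shift_fset opprK mem_before -(precDl x y 0) addr0 [x + y]addrC => /andP[].
have := @volume_asymp_sum R d (fun V x => cond_entropy x (before V x)) D
  (inf S) e (cond_entropy 0 fset0).
have -> : (fun V => \sum_(x <- V) cond_entropy x (before V x)) = shannon.
  by apply/funext => V; rewrite -telescope_before shannon0 subr0.
apply => //.
- move=> V x xV Dx; have := lower V x.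
  have : cond_entropy x (before V x) <= cond_entropy 0 D.
    rewrite toorigin; apply: cond_entropy_mono.
      apply/fsubsetP => y yD; rewrite in_shift_fset opprK mem_before addrC Dx//=.
      by rewrite -[X in prec _ X]addr0 precDl pD.
    by rewrite in_shift_fset opprK add0r before_notin.
  move=> h1 h2; rewrite ger0_norm; lra.
- move=> V x xV; have := lower V x.
  have : cond_entropy x (before V x) <= cond_entropy 0 fset0.
    rewrite toorigin; apply: cond_entropy_mono => //.
    by rewrite in_shift_fset opprK add0r before_notin.
  move=> h1 h2; rewrite ger0_norm; lra.
- exact: ltW.
- exact: cond_entropy_ge0.
Qed.

End Shannon.

(** * Specifications *)

Section Specifications.
Context (R : realType) (d : nat) (E : finPointedType) (g : kernels R d E).
Local Notation Omega := (config E (site d)).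
Implicit Types (K L V W D : {fset site d}) (s t w : Omega) (x y : site d).
Implicit Types (mu nu : probability Omega R).

Definition spec L s w : R := fine (ker_at g L w (cylinder L s)).

Lemma ker_setT L w : ker_at g L w setT = 1%E.
Proof. exact: prob_kernel. Qed.

Lemma ker_le1 L w A : measurable A -> (ker_at g L w A <= 1)%E.
Proof. by move=> mA; rewrite -(ker_setT L w) le_measure ?inE. Qed.

Lemma ker_fin L w A : measurable A -> ker_at g L w A \is a fin_num.
Proof.
move=> mA; rewrite ge0_fin_numE// (le_lt_trans (ker_le1 L w mA))//.
exact: ltry.
Qed.

Lemma spec_EFin L s w : (spec L s w)%:E = ker_at g L w (cylinder L s).
Proof. by rewrite fineK// ker_fin//; exact: measurable_cylinder. Qed.

Lemma spec_ge0 L s w : 0 <= spec L s w.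
Proof. exact: fine_ge0. Qed.

Lemma spec_le1 L s w : spec L s w <= 1.
Proof. by rewrite -lee_fin spec_EFin ker_le1//; exact: measurable_cylinder. Qed.

Lemma spec_outside L s w w' : (forall x, x \notin L -> w x = w' x) ->
  spec L s w = spec L s w'.
Proof.
move=> ww; rewrite /spec /ker_at; congr (fine (g L _ _)).
by apply/funext => -[x xL]; rewrite /restr /= ww.
Qed.

Lemma dep_spec L w : dep L (spec L ^~ w).
Proof. by move=> s t st; rewrite /spec (cylinder_eq st). Qed.

Lemma measurable_ker L A : measurable A ->
  measurable_fun setT (fun w => ker_at g L w A).
Proof.
move=> mA; apply: (measurableT_comp (measurable_kernel (g L) A mA)).
exact: restr_measurable.
Qed.

Lemma measurable_spec L s : measurable_fun setT (spec L s).
Proof.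
apply/measurable_EFinP.
rewrite (_ : EFin \o _ = fun w => ker_at g L w (cylinder L s)).
  by apply: measurable_ker; exact: measurable_cylinder.
by apply/funext => w /=; rewrite spec_EFin.
Qed.

Lemma integrable_spec mu L s A : measurable A -> mu.-integrable A (EFin \o spec L s).
Proof.
move=> mA; apply: measurable_bounded_integrable => //.
- exact: (le_lt_trans (probability_le1 mu mA) (ltry 1)).
- apply: measurable_funS (measurable_spec L s) => //.
- exists 1; split=> // M M1 w _ /=; rewrite ger0_norm ?spec_ge0//.
  exact: le_trans (spec_le1 _ _ _) (ltW M1).
Qed.

Lemma spec_shift x L s w : spec_translation_invariant g ->
  spec (shift_fset x L) s w = spec L (tau x s) (tau x w).
Proof.
move=> tg; rewrite /spec tg; last exact: measurable_cylinder.
congr (fine (ker_at _ _ _ _)); apply/seteqP; split=> u.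
  by move=> [v /(cylinder_shift x L s v).1 h <-].
move=> h; exists (tau (- x) u); last by rewrite tauNK.
by apply/(cylinder_shift x L s); rewrite tauNK.
Qed.

Lemma nonnull_spec L : nonnull g -> L != fset0 ->
  exists2 a : R, 0 < a & forall s w, a <= spec L s w.
Proof.
move=> ng /ng[a [b [a0 _ _ ha _]]]; exists a => // s w.
rewrite -lee_fin spec_EFin (le_trans (ltW ha))//.
by apply: ereal_inf_lbound; exists (s, w).
Qed.

Lemma coord_sigma_cylinder (S : set (site d)) L s : [set` L] `<=` S ->
  coord_sigma S (cylinder L s).
Proof.
move=> LS; rewrite cylinderE bigcap_fset.
have sS : sigma_algebra setT (@coord_sigma d E S) by exact: smallest_sigma_algebra.
pose T := g_sigma_algebraType
  [set B | exists2 x, S x & exists e : E, B = [set w : Omega | w x = e]].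
rewrite big_seq.
apply: (@big_ind _ (fun B => @measurable _ T B)).
- exact: measurableT.
- by move=> A B; exact: measurableI.
- move=> x xL; apply: sub_sigma_algebra; exists x; first exact: LS.
  by exists (s x).
Qed.

Lemma coord_sigma_measurable (S : set (site d)) B :
  @coord_sigma d E S B -> measurable B.
Proof.
apply: smallest_sub; first exact: sigma_algebra_measurable.
move=> _ [x _ [e ->]]; apply: sub_sigma_algebra; exact: coord_open.
Qed.

Lemma local_cylinder L s : local_fun (\1_(cylinder L s) : Omega -> R).
Proof.
exists L => C _.
pose T := g_sigma_algebraType
  [set B | exists2 x, [set` L] x & exists e : E, B = [set w : Omega | w x = e]].
have mL : @measurable _ T (cylinder L s) by exact: coord_sigma_cylinder.
rewrite preimage_indic.
case: ifP => _; case: ifP => _.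
- exact: (@measurableT _ T).
- exact: mL.
- exact: (@measurableC _ T).
- exact: (@measurable0 _ T).
Qed.

(** Uniformity in [s] is free, because a kernel only sees the finitely many windows
    of [s] on [L]. *)
Lemma quasilocal_window L e : quasilocal g -> 0 < e -> exists D,
  forall s w w', cylinder D w w' -> `|spec L s w' - spec L s w| <= e.
Proof.
move=> qg e0.
have specE s : (fun w => \int[ker_at g L w]_v \1_(cylinder L s) v) = spec L s.
  apply/funext => w; rewrite /Rintegral integral_indic ?setIT//.
  exact: measurable_cylinder.
have /choice[D hD] (f : {ffun L -> E}) : exists D, forall w w', cylinder D w w' ->
    `|spec L (ext f) w' - spec L (ext f) w| <= e.
  apply: continuous_window => //; rewrite -specE; apply: qg.
  exact: local_cylinder.
exists (\bigcup_(f <- index_enum {ffun L -> E}) D f)%fset => s w w' ww'.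
rewrite !(dep_spec _ (@windowK _ _ L s)).
by apply: hD; apply: cylinder_sub ww'; apply: bigfcup_sup.
Qed.

End Specifications.

(** * Gibbs measures on finite windows *)

Section GibbsWindows.
Context (R : realType) (d : nat) (E : finPointedType) (g : kernels R d E).
Local Notation Omega := (config E (site d)).
Implicit Types (K L V W D : {fset site d}) (s t w : Omega) (x y : site d).
Context (nu : probability Omega R).
Context (nu_gibbs : gibbs g nu).

Lemma gibbs_cylinder L K s t : [disjoint K & L]%fset ->
  fine (nu (cylinder L s `&` cylinder K t)) = \int[nu]_(w in cylinder K t) spec g L s w.
Proof.
move=> KL; have [_ hK] := nu_gibbs L (@measurable_cylinder d E L s).
rewrite -hK; last first.
  by apply: coord_sigma_cylinder => x; apply/fdisjointP.
by rewrite /Rintegral; congr fine; apply: eq_integral => w _; rewrite spec_EFin.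
Qed.

Lemma gibbs_cylinder_bounds L K s t (a b : R) : [disjoint K & L]%fset ->
  (forall w, cylinder K t w -> a <= spec g L s w <= b) ->
  a * Pr nu K t <= fine (nu (cylinder L s `&` cylinder K t)) <= b * Pr nu K t.
Proof.
move=> KL ab; rewrite gibbs_cylinder//.
have mK := @measurable_cylinder d E K t.
have intc (c : R) : nu.-integrable (cylinder K t) (EFin \o (fun=> c)).
  apply: measurable_bounded_integrable => //.
    exact: (le_lt_trans (probability_le1 nu mK) (ltry 1)).
  by exists `|c|; split=> // M M1 w _ /=; exact: ltW.
have ints := integrable_spec g nu L s mK.
rewrite /Pr -!(Rintegral_cst nu mK); apply/andP.
by split; apply: le_Rintegral => // w /ab/andP[].
Qed.

Lemma gibbs_window_bounds L K s (a b : R) : [disjoint K & L]%fset ->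
  (forall w, cylinder K s w -> a <= spec g L s w <= b) ->
  a * Pr nu K s <= Pr nu (L `|` K)%fset s <= b * Pr nu K s.
Proof. by move=> KL ab; rewrite /Pr cylinderU; exact: gibbs_cylinder_bounds. Qed.

(** Averaging the uniform lower bound on the kernels. *)
Lemma gibbs_Pr_gt0 L s : nonnull g -> 0 < Pr nu L s.
Proof.
move=> ng; have [->|L0] := eqVneq L fset0; first by rewrite Pr0.
have [a a0 ha] := nonnull_spec ng L0.
have /andP[h _] : a * Pr nu fset0 s <= Pr nu (L `|` fset0)%fset s <= 1 * Pr nu fset0 s.
  by apply: gibbs_window_bounds => [|w _]; [exact: fdisjoint0X|rewrite ha spec_le1].
by move: h; rewrite Pr0 mulr1 fsetU0; exact: lt_le_trans.
Qed.

End GibbsWindows.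

(** * Energy of a Gibbs measure *)

Section Energy.
Context (R : realType) (d : nat) (E : finPointedType) (g : kernels R d E).
Local Notation Omega := (config E (site d)).
Implicit Types (K L V W D : {fset site d}) (s t w : Omega) (x y : site d).
Implicit Types (mu nu : probability Omega R).
Context (ng : nonnull g).
Context (tg : spec_translation_invariant g).
Context (qg : quasilocal g).

Definition mix W s : Omega := fun y => if y \in W then s y else point.

Lemma cylinder_mixT W s : cylinder W s (mix W s).
Proof. by move=> y yW; rewrite /mix yW. Qed.

Definition energy nu V s : R := ln (Pr nu V s) - ln (Pr nu V (mix fset0 s)).

(** Contribution of the origin to the energy when the sites of [D] are already
    filled according to [s] and the others carry the reference symbol. *)
Definition site_energy D s : R :=
  ln (spec g [fset 0]%fset s (mix D s)) -
  ln (spec g [fset 0]%fset (mix fset0 s) (mix D s)).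

Lemma ln_sub_le (u c a : R) e : 0 < a -> a <= u -> a <= c -> `|u - c| <= e * a ->
  `|ln u - ln c| <= e.
Proof.
move=> a0 au ac.
have key p q : a <= p -> a <= q -> `|p - q| <= e * a -> ln p - ln q <= e.
  move=> ap aq pq; have p0 : 0 < p by lra. 
  have q0 : 0 < q by lra.
  rewrite -ln_div ?posrE//; apply: le_trans (ln_le_sub1 (divr_gt0 p0 q0)) _.
  have -> : p / q - 1 = (p - q) / q by rewrite mulrBl divff ?gt_eqF.
  rewrite ler_pdivrMr//; apply: le_trans (ler_norm _) (le_trans pq _).
  have e0 : 0 <= e by rewrite -(pmulr_lge0 _ a0) (le_trans _ pq).
  by rewrite ler_wpM2l.
move=> uc; rewrite ler_norml; apply/andP; split; last exact: key.
by rewrite lerNl opprB key// distrC.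
Qed.

Lemma origin_bound : exists2 a : R, 0 < a <= 1 &
  forall x s w, a <= spec g [fset x]%fset s w.
Proof.
have /(nonnull_spec ng)[a a0 ha] : [fset (0 : site d)]%fset != fset0.
  by apply/fset0Pn; exists 0; rewrite inE.
exists a => [|x s w]; first by rewrite a0 (le_trans (ha point point))// spec_le1.
by rewrite -[x]add0r -shift_fset1 spec_shift.
Qed.

(** By the Gibbs property the quotient of the two probabilities is an average of
    the kernel at [x] over the configurations agreeing with [s] on the rest of
    [V]. *)
Lemma site_ratio nu (a : R) V x s : gibbs g nu -> 0 < a ->
  (forall w, a <= spec g [fset x]%fset s w) -> x \in V ->
  ln a <= ln (Pr nu V s) - ln (Pr nu (V `\ x)%fset s) <= 0 /\
  forall c e, a <= c ->
    (forall w, cylinder (V `\ x)%fset s w ->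
      `|spec g [fset x]%fset s w - c| <= e * a) ->
    `|ln (Pr nu V s) - ln (Pr nu (V `\ x)%fset s) - ln c| <= e.
Proof.
move=> nug a0 ha xV.
have p0 L : 0 < Pr nu L s := gibbs_Pr_gt0 nug L s ng.
have dx : [disjoint (V `\ x) & [fset x]]%fset by rewrite fdisjointX1 !inE eqxx.
rewrite -ln_div ?posrE ?p0//.
have bounds b c : (forall w, cylinder (V `\ x)%fset s w ->
    b <= spec g [fset x]%fset s w <= c) ->
    b <= Pr nu V s / Pr nu (V `\ x)%fset s <= c.
  move=> h; have := gibbs_window_bounds nug dx h.
  by rewrite fsetD1K// ler_pdivlMr// ler_pdivrMr.
have /andP[u1 u2] : a <= Pr nu V s / Pr nu (V `\ x)%fset s <= 1.
  by apply: bounds => w _; rewrite ha spec_le1.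
split.
  by rewrite -(ln1 R) !ler_ln ?posrE ?u1 ?u2// (lt_le_trans a0).
move=> c e ac hc; apply: (ln_sub_le a0) => //.
have : c - e * a <= Pr nu V s / Pr nu (V `\ x)%fset s <= c + e * a.
  by apply: bounds => w /hc; rewrite ler_distl.
by rewrite ler_distl.
Qed.

(** Each step of the telescoping compares two configurations differing at one
    site; by the single-site Gibbs property the ratio of their probabilities is a
    ratio of single-site kernels, which far from the boundary only depend on the
    neighbouring sites. *)
Lemma energy_site_energy e : 0 < e -> exists D r (C : R), 0 <= C /\
  forall nu, gibbs g nu -> forall V s,
  `|energy nu V s - \sum_(x <- V) site_energy D (tau x s)| <=
    e * #|` V|%:R + C * #|` inner_boundary r V|%:R.
Proof.
move=> e0; have [a /andP[a0 a1] ha] := origin_bound.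
have ea : 0 < e / 2 * a by rewrite mulr_gt0// divr_gt0.
have [D0 hD0] := quasilocal_window [fset 0]%fset qg ea.
pose D := [fset z in D0 | prec z 0]%fset.
have [r hr] := sum_boundary_le R D0.
have lna : 0 <= - ln a by rewrite oppr_ge0 -[leRHS](ln1 R) ler_ln ?posrE.
(* crude bound: two log-ratios of probabilities and two logarithms of kernels, all
   between [ln a] and 0 *)
exists D, r, (- ln a *+ 4); split=> [|nu nug V s]; first by rewrite mulrn_wge0.
pose F W := ln (Pr nu V (mix W s)).
have -> : energy nu V s = F V - F fset0.
  by rewrite /F (dep_Pr nu (@cylinder_mixT V s)).
rewrite telescope_before -sumrB.
pose c t x := spec g [fset 0]%fset t (mix D (tau x s)).
have c_ge t x : a <= c t x by exact: ha.
have c_bound t x : ln a <= ln (c t x) <= 0.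
  have c0 := lt_le_trans a0 (c_ge t x).
  by rewrite -(ln1 R) !ler_ln ?posrE// c_ge spec_le1.
have PrVx x : Pr nu (V `\ x)%fset (mix (x |` before V x)%fset s) =
    Pr nu (V `\ x)%fset (mix (before V x) s).
  apply: dep_Pr => y; rewrite /mix !in_fset1U !in_fsetD1 => /andP[/negbTE-> _].
  by [].
have siteE x : site_energy D (tau x s) =
    ln (c (tau x (mix (x |` before V x)%fset s)) x) -
    ln (c (tau x (mix (before V x) s)) x).
  rewrite /site_energy /c; congr (ln _ - ln _); apply: dep_spec => y;
    rewrite inE => /eqP->; rewrite /tau /mix addr0 ?in_fset1U ?eqxx//.
  by rewrite (negbTE (before_notin _ _)).
have SR t x xV := @site_ratio nu a V x t nug a0 (ha x t) xV.
apply: hr; last exact: ltW.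
- move=> x xV xD.
  have near_c t w : cylinder (V `\ x)%fset (mix (before V x) s) w ->
      `|spec g [fset x]%fset t w - c (tau x t) x| <= e / 2 * a.
    move=> wV; rewrite -{1}[x]add0r -shift_fset1 spec_shift//.
    (* the symbol at the origin is not seen by the kernel of the origin *)
    pose w' := upd (tau x w) 0 point.
    rewrite (@spec_outside _ _ _ g [fset 0]%fset (tau x t) (tau x w) w'); last first.
      by move=> y; rewrite inE /w' /upd => /negbTE->.
    apply: hD0 => z zD; rewrite /w' /upd.
    case: eqP => [->|/eqP z0]; first by rewrite /mix !inE precxx andbF.
    rewrite /tau (wV (x + z)).
      rewrite /mix mem_before xD//= -[X in prec _ X]addr0 precDl !inE zD /=.
      by [].
    by rewrite !inE xD// andbT -subr_eq0 addrC addKr.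
  have [_ h1] := SR (mix (x |` before V x)%fset s) x xV.
  have [_ h2] := SR (mix (before V x) s) x xV.
  have {}h2 := h2 _ (e / 2) (c_ge _ x) (near_c _).
  have {}h1 : `|ln (Pr nu V (mix (x |` before V x)%fset s)) -
      ln (Pr nu (V `\ x)%fset (mix (x |` before V x)%fset s)) -
      ln (c (tau x (mix (x |` before V x)%fset s)) x)| <= e / 2.
    apply: h1 => // w hw; apply: near_c => y yV; rewrite (hw _ yV) /mix in_fset1U.
    by move: yV; rewrite in_fsetD1 => /andP[/negbTE-> _].
  rewrite siteE /F; rewrite PrVx in h1.
  move: h1 h2; rewrite !ler_norml => /andP[? ?] /andP[? ?].
  apply/andP; split; lra.
- move=> x xV; rewrite siteE /F.
  have [/andP[h1 h2] _] := SR (mix (x |` before V x)%fset s) x xV.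
  have [/andP[h3 h4] _] := SR (mix (before V x) s) x xV.
  rewrite PrVx in h1 h2.
  have /andP[h5 h6] := c_bound (tau x (mix (x |` before V x)%fset s)) x.
  have /andP[h7 h8] := c_bound (tau x (mix (before V x) s)) x.
  rewrite ler_norml -mulr_natr; apply/andP; split; lra.
Qed.

Lemma dep_energy nu V : dep V (energy nu V).
Proof.
by move=> s w sw; rewrite /energy (dep_Pr nu sw).
Qed.

Lemma dep_site_energy D : dep (0 |` D)%fset (site_energy D).
Proof.
move=> s w sw; have mixE : mix D w = mix D s.
  apply/funext => y; rewrite /mix; case: ifP => // yD.
  by apply: sw; rewrite !inE yD orbT.
rewrite /site_energy mixE; congr (ln _ - ln _).
by apply: dep_spec => y; rewrite inE => /eqP->; apply: sw; rewrite !inE eqxx.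
Qed.

Lemma Ex_norm_le mu L (F : Omega -> R) c : dep L F -> (forall w, `|F w| <= c) ->
  `|Ex mu F| <= c.
Proof.
move=> dF Fc; rewrite ler_norml; apply/andP; split.
  rewrite -(Ex_cst mu (- c)); apply: (@Ex_le _ _ _ _ L) => // w _.
  by have := Fc w; rewrite ler_norml => /andP[].
rewrite -[leRHS](Ex_cst mu c); apply: (@Ex_le _ _ _ _ L) => // w _.
exact: le_trans (ler_norm _) (Fc w).
Qed.

(** By invariance all the translates of the local approximation have the same mean. *)
Lemma energy_asymp mu nu e : gibbs g nu -> translation_invariant mu -> 0 < e ->
  exists l, volume_asymp (fun V => Ex mu (energy nu V)) l e.
Proof.
move=> nug tmu e0; have [D [r [C [C0 h]]]] := energy_site_energy e0.
exists (Ex mu (site_energy D)), r, C; split=> // V.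
pose M := (V `|` \bigcup_(x <- V) shift_fset x (0 |` D))%fset.
have dterm x : x \in V -> dep M (fun s => site_energy D (tau x s)).
  move=> xV; apply: dep_sub (dep_shift (x := x) (@dep_site_energy D)).
  apply: fsubset_trans (fsubsetUr _ _).
  exact: (@bigfcup_sup _ _ _ _ (fun=> true) (fun y => shift_fset y (0 |` D)%fset)).
have -> : #|` V|%:R * Ex mu (site_energy D) =
    Ex mu (fun s => \sum_(x <- V) site_energy D (tau x s)).
  rewrite (@Ex_big _ _ _ mu _ _ M)//.
  transitivity (\sum_(x <- V) Ex mu (site_energy D)).
    by rewrite big_const_seq count_predT iter_addr addr0 mulr_natl.
  by apply: eq_bigr => x _; rewrite -(Ex_shift x tmu (@dep_site_energy D)).
have dV : dep M (energy nu V).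
  by apply: dep_sub (@dep_energy nu V); exact: fsubsetUl.
have dsum : dep M (fun s => \sum_(x <- V) site_energy D (tau x s)).
  by move=> s w sw; apply: eq_big_seq => x xV; exact: dterm.
rewrite -(@ExB _ _ _ _ M)//; apply: (@Ex_norm_le _ M); first exact: depB.
by move=> s; exact: h.
Qed.

End Energy.

(** * Relative entropy density *)

Section RelativeEntropyDensity.
Context (R : realType) (d : nat) (E : finPointedType).
Local Notation Omega := (config E (site d)).
Implicit Types (K L V W D : {fset site d}) (s t w : Omega) (x y : site d).
Implicit Types (mu nu : probability Omega R).

Lemma window_point_measurable L (t : config E {x | x \in L}) : measurable [set t].
Proof.
apply: sub_sigma_algebra.
pose B (y : L) := [set u : config E {x | x \in L} |
  u (exist _ (val y) (valP y)) = t (exist _ (val y) (valP y))].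
have -> : [set t] = \bigcap_(y in [set` index_enum L]) B y.
  apply/seteqP; split=> [u -> y _ //|u h]; apply/funext => -[x xL].
  have := h [` xL]%fset (mem_index_enum _); rewrite /B /=.
  by rewrite (Prop_irrelevance (valP [` xL]%fset) xL).
rewrite bigcap_seq; apply: big_ind; [exact: openT|by move=> P Q; exact: openI|].
move=> y _; have /continuousP/(_ [set t (exist _ (val y) (valP y))]) :=
  @Defs.coord_continuous E {x | x \in L} (exist _ (val y) (valP y)).
apply; exact: discrete_open.
Qed.

Lemma restr_preimage L s :
  @restr E _ (fun x => x \in L) @^-1` [set @restr E _ (fun x => x \in L) s] = cylinder L s.
Proof.
apply/seteqP; split=> [w /= ws x xL|w ws /=].
  exact: (congr1 (fun u : config E {x | x \in L} => u (exist _ x xL)) ws).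
by apply/funext => -[x xL]; exact: ws.
Qed.

Lemma restr_surj L (t : config E {x | x \in L}) :
  exists s, @restr E _ (fun x => x \in L) s = t.
Proof.
exists (fun x => if (insub x : option {x | x \in L}) is Some y then t y else point).
by apply/funext => y; rewrite /restr valK.
Qed.

(** The marginal of [nu] charges every point of a finite space, where the
    Radon-Nikodym derivative is then the quotient of the masses of points. *)
Lemma rel_entropyE L mu nu : (forall s, 0 < Pr nu L s) ->
  rel_entropy L mu nu = (kl mu nu L)%:E.
Proof.
move=> nu0; pose rs := @restr E _ (fun x => x \in L).
have dom : marginal mu L `<< marginal nu L.
  move=> A nuA B mB BA; have := nuA B mB BA.
  have [->|/set0P[t Bt] nuB0] := eqVneq B set0; first by rewrite !measure0.
  have [s st] := restr_surj t.
  suff : (0 < marginal nu L B)%E by rewrite nuB0 ltxx.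
  apply: lt_le_trans (_ : (Pr nu L s)%:E <= _)%E; first by rewrite lte_fin.
  rewrite Pr_EFin -restr_preimage; apply: le_measure; rewrite ?inE.
  - by rewrite restr_preimage; exact: measurable_cylinder.
  - by rewrite -[_ @^-1` _]setTI; apply: restr_measurable.
  - by move=> w /= ->; rewrite st.
rewrite /rel_entropy; case: asboolP => // _.
set RN := Radon_Nikodym _ _.
have RNE s : fine (RN (rs s)) = Pr mu L s / Pr nu L s.
  have mt := window_point_measurable (rs s).
  have := @Radon_Nikodym_integral _ _ _ (charge_of_finite_measure (marginal mu L))
    (marginal nu L) _ dom mt.
  rewrite (eq_integral (fun=> RN (rs s))); last first.
    by move=> u; rewrite inE => ->.
  have RNfin := @Radon_Nikodym_fin_num _ _ _ (charge_of_finite_measure (marginal mu L))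
    (marginal nu L) (rs s) dom.
  rewrite -/RN in RNfin *.
  rewrite -(fineK RNfin) integral_cst// => h.
  have h' : Pr mu L s = fine (RN (rs s)) * Pr nu L s.
    apply: EFin_inj; rewrite EFinM !Pr_EFin -restr_preimage.
    exact: h.
  by rewrite h' mulfK// gt_eqF.
pose F s := Pr mu L s / Pr nu L s * ln (Pr mu L s / Pr nu L s).
have dF : dep L F.
  have dr : dep L (fun s => Pr mu L s / Pr nu L s).
    apply: depM; first exact: dep_Pr.
    by apply: (@dep_comp _ _ _ _ _ (fun u : R => u^-1)); exact: dep_Pr.
  by apply: depM => //; exact: dep_ln.
have FE : (fun t : config E {x | x \in L} =>
    (fine (RN t) * ln (fine (RN t)))%:E) \o rs = EFin \o F.
  by apply/funext => s /=; rewrite RNE.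
have mRN : measurable_fun setT (fine \o RN).
  apply: measurableT_comp => //.
  exact: measurable_int (@Radon_Nikodym_integrable _ _ _
    (charge_of_finite_measure (marginal mu L)) (marginal nu L) dom).
rewrite /marginal integral_distribution; last 2 first.
- by apply/measurable_EFinP; apply: measurable_funM => //; exact: measurableT_comp.
- by rewrite FE; exact: integrable_dep dF.
rewrite FE -[LHS]fineK; last by apply: integrable_fin_num => //; exact: integrable_dep dF.
congr (_%:E); rewrite -[LHS]/(Ex nu F) /kl (Ex_sumE _ dF) (@Ex_sumE _ _ _ mu L).
  apply: eq_bigr => f _; have nuf := nu0 (ext f).
  rewrite /F mulrAC divfK ?gt_eqF//.
  have := Pr_ge0 mu L (ext f); rewrite le0r => /predU1P[->|muf].
    by rewrite !mul0r mulr0.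
  by rewrite ln_div// mulrC.
by apply: depB; exact: dep_lnPr.
Qed.

(** The probability of the reference configuration is a constant, hence cancels in
    the difference of the two expectations of the energy. *)
Lemma kl_decomp mu nu V : kl mu nu V =
  (shannon nu V - shannon mu V) - (Ex mu (energy nu V) - Ex nu (energy nu V)).
Proof.
have dl m : dep V (fun w => ln (Pr m V w)) by exact: dep_lnPr.
rewrite /kl (@ExB _ _ _ _ V)// /shannon.
have enE m : Ex m (energy nu V) =
    Ex m (fun w => ln (Pr nu V w)) - ln (Pr nu V (mix fset0 (point : Omega))).
  rewrite -[X in _ = _ - X](Ex_cst m) -(@ExB _ _ _ _ V)//.
rewrite !enE; lra.
Qed.

Context (g : kernels R d E).
Context (ng : nonnull g).
Context (tg : spec_translation_invariant g).
Context (qg : quasilocal g).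

Lemma kl_asymp mu nu e : gibbs g nu -> translation_invariant nu ->
  translation_invariant mu -> 0 < e -> exists l, volume_asymp (kl mu nu) l e.
Proof.
move=> nug tnu tmu e0; have e4 : 0 < e / 4 by rewrite divr_gt0.
have [s1 /(_ _ e4) h1] := shannon_asymp tnu.
have [s2 /(_ _ e4) h2] := shannon_asymp tmu.
have [l1 h3] := energy_asymp ng tg qg nug tmu e4.
have [l2 h4] := energy_asymp ng tg qg nug tnu e4.
exists (s1 - s2 - (l1 - l2)).
have := volume_asympB (volume_asympB h1 h2) (volume_asympB h3 h4).
have -> : e / 4 + e / 4 + (e / 4 + e / 4) = e by lra.
by congr (volume_asymp _ _ _); apply/funext => V; rewrite kl_decomp.
Qed.

(** The two relative entropies are nonnegative, and their sum only involves the
    difference of the energies, which for two Gibbs measures of the same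
    specification is a boundary term. *)
Lemma gibbs_kl_asymp mu nu e : gibbs g mu -> gibbs g nu -> 0 < e ->
  volume_asymp (kl mu nu) 0 e.
Proof.
move=> mug nug e0; have e4 : 0 < e / 4 by rewrite divr_gt0.
have [D [r [C [C0 h]]]] := energy_site_energy ng tg qg e4.
exists r, (C * 4); split=> [|V]; first by rewrite mulr_ge0.
pose F s := energy mu V s - energy nu V s.
have dF : dep V F by apply: depB; exact: dep_energy.
have F_le s : `|F s| <= (e / 2) * #|` V|%:R + (C * 2) * #|` inner_boundary r V|%:R.
  have := h mu mug V s; have := h nu nug V s; rewrite /F !ler_norml.
  by move=> /andP[? ?] /andP[? ?]; apply/andP; split; lra.
have hsum : kl mu nu V + kl nu mu V = Ex mu F - Ex nu F.
  have dE (m : probability Omega R) : dep V (energy m V) by exact: dep_energy.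
  by rewrite !kl_decomp /F !(ExB _ (dE mu) (dE nu)); lra.
have h1 := Ex_norm_le mu dF F_le; have h2 := Ex_norm_le nu dF F_le.
have k1 := @kl_ge0 _ _ _ mu nu V (fun s => gibbs_Pr_gt0 nug V s ng).
have k2 := @kl_ge0 _ _ _ nu mu V (fun s => gibbs_Pr_gt0 mug V s ng).
rewrite mulr0 subr0 ger0_norm//.
move: h1 h2; rewrite !ler_norml => /andP[? ?] /andP[? ?]; lra.
Qed.

End RelativeEntropyDensity.

(** * Zero relative entropy density forces the Gibbs property *)

Section Increments.
Context (R : realType) (d : nat) (E : finPointedType).
Local Notation Omega := (config E (site d)).
Implicit Types (K L W D U : {fset site d}) (s t w : Omega) (x y : site d).
Context (mu nu : probability Omega R).
Context (tmu : translation_invariant mu).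
Context (tnu : translation_invariant nu).
Context (nu0 : forall L s, 0 < Pr nu L s).

(** Greedy packing: each step removes from [W] the translate of [L] by a point [x] of
    [U], which costs at least [e], and drops from [U] the boundedly many points
    whose neighbourhood met this translate. *)
Lemma kl_packing L D e : 0 <= e ->
  (forall W, (D `<=` W)%fset -> e <= kl mu nu W - kl mu nu (W `\` L)%fset) ->
  exists b : nat, forall U W,
    (forall x, x \in U -> (shift_fset x D `<=` W)%fset) ->
    e * #|` U|%:R <= b%:R * kl mu nu W.
Proof.
move=> e0 he.
pose N : {fset site d} := [fset (a - b)%R | a in L, b in D]%fset.
(* 0 makes the chosen point itself leave [U], even if [L] or [D] is empty *)
pose M : {fset site d} := (0 |` N)%fset.
exists #|` M| => U.
have [n] := ubnP #|` U|; elim: n U => // n ih U Un W UW.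
have [->|/fset0Pn[x xU]] := eqVneq U fset0.
  by rewrite cardfs0 mulr0 mulr_ge0// kl_ge0.
pose U' := (U `\` shift_fset x M)%fset.
have xx : x \in shift_fset x M.
  by rewrite in_shift_fset subrr in_fset1U eqxx.
have U'n : (#|` U'| < n)%N.
  rewrite ltnS in Un; apply: leq_trans Un; apply: fproper_ltn_card.
  rewrite fproperEneq fsubsetDl andbT; apply/negP => /eqP U'U.
  by move: xU; rewrite -U'U in_fsetD xx.
have U'W y : y \in U' -> (shift_fset y D `<=` W `\` shift_fset x L)%fset.
  rewrite in_fsetD => /andP[yN yU]; apply/fsubsetP => z zy.
  rewrite in_fsetD (fsubsetP (UW _ yU) _ zy) andbT.
  apply: contra yN; rewrite !in_shift_fset in zy * => zx.
  rewrite in_fset1U; apply/orP; right; apply/imfset2P.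
  by exists (z - x) => //; exists (z - y) => //; rewrite opprB [RHS]addrC addrA subrK.
have step : e <= kl mu nu W - kl mu nu (W `\` shift_fset x L)%fset.
  have WL : (shift_fset (- x) W `\` L)%fset = shift_fset (- x) (W `\` shift_fset x L)%fset.
    by rewrite shift_fsetD shift_fsetK.
  have := he (shift_fset (- x) W); rewrite WL !kl_shift//; apply.
  apply/fsubsetP => z zD; rewrite in_shift_fset opprK.
  by apply: (fsubsetP (UW _ xU)); rewrite in_shift_fset addrK.
have card : (#|` U| <= #|` U'| + #|` M|)%N.
  have <- : #|` shift_fset x M| = #|` M| by rewrite card_imfset//; exact: addIr.
  rewrite -(cardfsID (shift_fset x M) U) addnC leq_add2l.
  exact/fsubset_leq_card/fsubsetIr.
have {}ih := ih U' U'n _ U'W.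
have : e * #|` U|%:R <= e * (#|` U'| + #|` M|)%:R by rewrite ler_wpM2l// ler_nat.
have : #|` M|%:R * e <= #|` M|%:R * (kl mu nu W - kl mu nu (W `\` shift_fset x L)%fset).
  by rewrite ler_wpM2l.
rewrite natrD; lra.
Qed.

(** Otherwise packing would give a relative entropy proportional to the volume, taking
    for [U] the points outside the inner boundary. *)
Lemma kl_small_increment V L D e : van_hove R V ->
  (#|` V n|%:R^-1 * kl mu nu (V n)) @[n --> \oo] --> (0 : R) -> 0 < e ->
  exists2 W, (D `<=` W)%fset & kl mu nu W - kl mu nu (W `\` L)%fset < e.
Proof.
move=> VV h0 e0; apply: contrapT => hn.
have he W : (D `<=` W)%fset -> e <= kl mu nu W - kl mu nu (W `\` L)%fset.
  by move=> DW; rewrite leNgt; apply/negP => lt; apply: hn; exists W.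
have [b hb] := kl_packing (ltW e0) he.
have [r hr] := bulk_window D.
have [V0 /(_ r)] := VV.
have q1 : 0 < 1 / 4 :> R by lra.
have q2 : 0 < e / (4 * (b%:R + 1)) :> R by rewrite divr_gt0// mulr_gt0// ltr_wpDl.
move=> /cvgrPdist_lt/(_ _ q1) near1.
move/cvgrPdist_lt : h0 => /(_ _ q2) near2.
have [n [/= n1 n2]] := filter_ex (filterI near1 near2).
have v0 : 0 < #|` V n|%:R :> R by rewrite ltr0n cardfs_gt0.
have k0 : 0 <= kl mu nu (V n) by exact: kl_ge0.
have hU x : x \in (V n `\` inner_boundary r (V n))%fset -> (shift_fset x D `<=` V n)%fset.
  rewrite in_fsetD => /andP[xb xV]; apply/fsubsetP => z.
  by rewrite in_shift_fset => /(hr _ _ xV xb); rewrite addrC subrK.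
have := hb _ _ hU.
rewrite cardfsDS ?inner_boundary_sub// natrB; last exact/fsubset_leq_card/inner_boundary_sub.
move: n1; rewrite sub0r normrN ger0_norm ?divr_ge0// ltr_pdivrMr// => n1.
move: n2; rewrite sub0r normrN ger0_norm ?mulr_ge0 ?invr_ge0// mulrC ltr_pdivrMr// => n2.
have b1 : 0 < b%:R + 1 :> R by rewrite ltr_wpDl.
have n3 : (b%:R + 1) * kl mu nu (V n) < e / 4 * #|` V n|%:R.
  have := n2; rewrite -(ltr_pM2l b1) => /lt_le_trans; apply.
  by rewrite mulrA [_ * (e / _)]mulrC invfM [e * (_ * _)]mulrA divfK ?gt_eqF.
have : e * #|` inner_boundary r (V n)|%:R < e * (1 / 4 * #|` V n|%:R) by rewrite ltr_pM2l.
have : 0 < e * #|` V n|%:R by rewrite mulr_gt0.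
lra.
Qed.

End Increments.

Section WindowEquation.
Context (R : realType) (d : nat) (E : finPointedType) (g : kernels R d E).
Local Notation Omega := (config E (site d)).
Implicit Types (K L W D U : {fset site d}) (s t w : Omega) (x y : site d).
Context (mu nu : probability Omega R).
Context (nug : gibbs g nu).
Context (nu0 : forall L s, 0 < Pr nu L s).

(** Conditional [nu]-probability of the cylinder [s] on [L] given the window
    [K]. *)
Definition window_spec L K s w : R :=
  fine (nu (cylinder L s `&` cylinder K w)) / Pr nu K w.

Lemma dep_window_spec L K s : dep K (window_spec L K s).
Proof.
by move=> t w tw; rewrite /window_spec (cylinder_eq tw) (dep_Pr nu tw).
Qed.

(** The Gibbs property makes [window_spec] an average of the kernel over
    configurations that agree with [w] on [D] outside [L]. *)
Lemma window_spec_near L D W s e :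
  (forall s w w', cylinder D w w' -> `|spec g L s w' - spec g L s w| <= e) ->
  (D `<=` W)%fset ->
  forall w, `|window_spec L (W `\` L)%fset s w - spec g L s w| <= e.
Proof.
move=> hD DW w; have WL : [disjoint (W `\` L) & L]%fset.
  by apply/fdisjointP => x; rewrite in_fsetD => /andP[].
have h w' : cylinder (W `\` L)%fset w w' -> 
    spec g L s w - e <= spec g L s w' <= spec g L s w + e.
  move=> ww'; rewrite -ler_distl.
  pose w'' : Omega := fun y => if y \in L then w y else w' y.
  rewrite (@spec_outside _ _ _ g L s w' w''); last first.
    by move=> y yL; rewrite /w'' (negbTE yL).
  apply: hD => y yD; rewrite /w''; case: ifPn => // yL.
  by apply: ww'; rewrite in_fsetD yL (fsubsetP DW).
have := gibbs_cylinder_bounds nug WL h.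
move=> /andP[]; rewrite -ler_pdivlMr// => h1; rewrite -ler_pdivrMr// => h2.
by rewrite ler_distl h1 h2.
Qed.

(** Disintegration of [nu] along the window [K]. *)
Lemma Ex_window_spec L K s (G : Omega -> R) : dep K G ->
  Ex nu (fun w => \1_(cylinder L s) w * (G w / Pr nu K w)) =
  \sum_(f : {ffun K -> E}) G (ext f) * window_spec L K s (ext f).
Proof.
move=> dG.
have dq : dep K (fun w => G w / Pr nu K w).
  apply: depM => //; apply: (@dep_comp _ _ _ _ _ (fun u : R => u^-1)).
  exact: dep_Pr.
pose I (f : {ffun K -> E}) := \1_(cylinder L s `&` cylinder K (ext f)) : Omega -> R.
have IE (f : {ffun K -> E}) w : I f w = \1_(cylinder L s) w * \1_(cylinder K (ext f)) w.
  by rewrite /I indicI.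
have dI f : dep (L `|` K)%fset (I f).
  have -> : I f = fun w => \1_(cylinder L s) w * \1_(cylinder K (ext f)) w.
    by apply/funext => w.
  by apply: depM; apply: dep_ind; [exact: fsubsetUl|exact: fsubsetUr].
rewrite (@eq_Ex _ _ _ _ _ (fun w => \sum_(f : {ffun K -> E})
    (G (ext f) / Pr nu K (ext f)) * I f w)); last first.
  move=> w; rewrite (dep_expand w dq) mulr_sumr; apply: eq_bigr => f _.
  by rewrite IE mulrCA.
rewrite (@Ex_big _ _ _ _ _ _ (L `|` K)%fset); last by move=> f _; exact: depM.
apply: eq_bigr => f _; rewrite (ExZ _ _ (dI f)) /window_spec mulrAC mulrA.
congr (_ / _); congr (_ * _).
rewrite /Ex /Rintegral integral_indic ?setIT//.
apply: measurableI; exact: measurable_cylinder.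
Qed.

(** The increment is the relative entropy of the law of [mu] on [W] with respect to
    the law [q] that has the marginal of [mu] on [W] minus [L] and the conditional
    law of [nu] on [L]. *)
Lemma window_spec_tv L L0 W s e : (L `<=` L0)%fset -> (L0 `<=` W)%fset ->
  0 < e -> e <= 1 / 2 ->
  kl mu nu W - kl mu nu (W `\` L)%fset <= e ^+ 2 ->
  `|Pr mu L0 s - Ex mu (fun w => \1_(cylinder (L0 `\` L)%fset s) w *
      window_spec L (W `\` L)%fset s w)| <= 3 * e.
Proof.
move=> LL0 L0W e0 e1 hkl; set K := (W `\` L)%fset.
have KW : (K `<=` W)%fset by exact: fsubsetDl.
have L0K : (L0 `\` L `<=` K)%fset by exact: fsetSD.
pose q w := Pr mu K w * Pr nu W w / Pr nu K w.
have depP (m : probability Omega R) M : (M `<=` W)%fset -> dep W (Pr m M).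
  by move=> h; apply: dep_sub h _; exact: dep_Pr.
have depV (m : probability Omega R) M : (M `<=` W)%fset -> dep W (fun w => (Pr m M w)^-1).
  by move=> h; apply: (@dep_comp _ _ _ _ _ (fun u : R => u^-1)); exact: depP.
have dq : dep W q by apply: depM; [apply: depM; exact: depP|exact: depV].
have q0 w : 0 <= q w by rewrite divr_ge0 ?mulr_ge0 ?Pr_ge0.
have pq w : 0 < Pr mu W w -> 0 < q w.
  by move=> w0; rewrite divr_gt0 ?mulr_gt0// (lt_le_trans w0)// Pr_sub.
have dKq : dep W (fun w => Pr mu K w / Pr nu K w) by apply: depM; [exact: depP|exact: depV].
have q1 : \sum_(f : {ffun W -> E}) q (ext f) = 1.
  transitivity (Ex nu (fun w => Pr mu K w / Pr nu K w)).
    by rewrite (Ex_sumE nu dKq); apply: eq_bigr => f _; rewrite /q mulrAC.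
  rewrite (@Ex_sumE _ _ _ nu K).
    rewrite -(sum_Pr mu K); apply: eq_bigr => f _; rewrite divfK// gt_eqF//.
  by apply: depM; [exact: dep_Pr|
    apply: (@dep_comp _ _ _ _ _ (fun u : R => u^-1)); exact: dep_Pr].
have := total_variation_le_kl dq q0 pq q1 (ltW e0) e1.
set S := \sum_(f : {ffun W -> E}) `|_|.
have -> : Ex mu (fun w => ln (Pr mu W w) - ln (q w)) =
    kl mu nu W - kl mu nu K.
  have dkl M : (M `<=` W)%fset -> dep W (fun w => ln (Pr mu M w) - ln (Pr nu M w)).
    by move=> MW; apply: depB; exact: dep_lnPr.
  rewrite -(ExB _ (dkl _ (fsubset_refl W)) (dkl _ KW)).
  apply: (@eq_Ex_supp _ _ _ _ W).
  - by apply: depB; [exact: dep_lnPr|exact: dep_ln].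
  - by apply: depB; apply: dkl.
  move=> w w0; have K0 : 0 < Pr mu K w by apply: lt_le_trans w0 _; exact: Pr_sub.
  by rewrite /q ln_div ?lnM ?posrE ?mulr_gt0//; lra.
move=> hS; have {hS} S3 : S <= 3 * e.
  rewrite -(ler_pM2l e0); apply: le_trans hS _.
  have -> : e * (3 * e) = 3 * e ^+ 2 by ring.
  lra.
apply: le_trans S3.
have UE : L0 = (L `|` (L0 `\` L))%fset.
  apply/fsetP => x; rewrite in_fsetU in_fsetD.
  by case xL : (x \in L) => //=; rewrite (fsubsetP LL0).
have dG : dep K (fun w => \1_(cylinder (L0 `\` L)%fset s) w * Pr mu K w).
  by apply: depM; [exact: dep_ind|exact: dep_Pr].
have -> : Ex mu (fun w => \1_(cylinder (L0 `\` L)%fset s) w * window_spec L K s w) =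
    \sum_(f : {ffun W -> E}) \1_(cylinder L0 s) (ext f) * q (ext f).
  rewrite (@Ex_sumE _ _ _ _ K); last first.
    by apply: depM; [exact: dep_ind|exact: dep_window_spec].
  under eq_bigr do rewrite mulrAC.
  rewrite -(Ex_window_spec L s dG) (@Ex_sumE _ _ _ _ W); last first.
    apply: depM; first by apply: dep_ind; exact: fsubset_trans LL0 L0W.
    by apply: depM; [exact: dep_sub dG|exact: depV].
  apply: eq_bigr => f _; rewrite [in RHS]UE cylinderU indicI /q /=; ring.
rewrite -Ex_cylinder (@Ex_sumE _ _ _ _ W); last exact: dep_ind.
rewrite -sumrB; apply: le_trans (ler_norm_sum _ _ _) _; apply: ler_sum => f _.
rewrite -mulrBr normrM ler_piMl// indicE.
by case: (_ \in _); rewrite ?normr1 ?normr0.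
Qed.

End WindowEquation.

Section WindowDLR.
Context (R : realType) (d : nat) (E : finPointedType) (g : kernels R d E).
Local Notation Omega := (config E (site d)).
Implicit Types (K L W D U : {fset site d}) (s t w : Omega) (x y : site d).
Context (mu nu : probability Omega R).
Context (nug : gibbs g nu).
Context (nu0 : forall L s, 0 < Pr nu L s).
Context (qg : quasilocal g).
Context (incr : forall L D e, 0 < e ->
  exists2 W, (D `<=` W)%fset & kl mu nu W - kl mu nu (W `\` L)%fset < e).

Lemma Ex_indicator L s (f : Omega -> R) :
  Ex mu (fun w => \1_(cylinder L s) w * f w) = \int[mu]_(w in cylinder L s) f w.
Proof.
rewrite Rintegral_mkcond; apply: eq_Ex => w; rewrite patchE indicE.
by case: ifP => _; rewrite ?mul1r ?mul0r.
Qed.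

(** For a window [W] with an increment at most [e ^+ 2], the [nu]-conditional
    probabilities given [W] are, on average, close to both sides. *)
Lemma window_dlr L L0 s : (L `<=` L0)%fset ->
  Pr mu L0 s = \int[mu]_(w in cylinder (L0 `\` L)%fset s) spec g L s w.
Proof.
move=> LL0; set I := (X in _ = X).
suff h e : 0 < e -> e <= 1 / 2 -> `|Pr mu L0 s - I| <= 4 * e.
  apply/eqP; rewrite -subr_eq0 -normr_le0 leNgt; apply/negP => t0.
  set t := `|_| in t0 h.
  have [t4|t4] := leP t 4.
    by have := h (t / 8) (divr_gt0 t0 _) _; lra.
  by have := h (1 / 2) _ _; lra.
move=> e0 e1; have [D hD] := quasilocal_window L qg e0.
have [W /fsubUsetP [L0W DW] hW] := incr L (L0 `|` D)%fset (exprn_gt0 2 e0).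
have := window_spec_tv nu0 s LL0 L0W e0 e1 (ltW hW).
rewrite Ex_indicator; set J := \int[mu]_(w in _) _ => h1.
suff h2 : `|J - I| <= e.
  have -> : Pr mu L0 s - I = (Pr mu L0 s - J) + (J - I) by ring.
  by apply: le_trans (ler_normD _ _) _; lra.
move=> {h1}; set C := cylinder _ _ in J I *.
have mC : measurable C by exact: measurable_cylinder.
have intJ : mu.-integrable C (EFin \o window_spec nu L (W `\` L)%fset s).
  apply: integrableS (integrable_dep mu (@dep_window_spec _ _ _ nu L _ s)) => //.
have intI := integrable_spec g mu L s mC.
rewrite /J /I -RintegralB//.
have intB : mu.-integrable C (EFin \o
    (fun w => window_spec nu L (W `\` L)%fset s w - spec g L s w)).
  exact: (integrableB mC intJ intI).
apply: le_trans (le_normr_Rintegral mC intB) _.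
apply: le_trans (_ : \int[mu]_(w in C) e <= _).
  apply: le_Rintegral => //.
  - exact: integrable_norm intB.
  - apply: measurable_bounded_integrable => //.
      exact: (le_lt_trans (probability_le1 mu mC) (ltry 1)).
    by exists `|e|; split=> // M M1 w _ /=; exact: ltW.
  - move=> w _; exact: (window_spec_near nug nu0 s hD DW).
rewrite Rintegral_cst//; apply: ler_piMr; first exact: ltW.
exact: (Pr_le1 mu (L0 `\` L)%fset s).
Qed.

End WindowDLR.

Section Resampling.
Context (R : realType) (d : nat) (E : finPointedType) (g : kernels R d E).
Local Notation Omega := (config E (site d)).
Implicit Types (K L W D U : {fset site d}) (s t w : Omega) (x y : site d).

(** The measure mu gamma_L. *)
Definition resample (mu : probability Omega R) L (A : set Omega) : \bar R :=
  (\int[mu]_w ker_at g L w A)%E.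

Context (mu : probability Omega R) (L : {fset site d}).

Let resample0 : resample mu L set0 = 0%E.
Proof. by rewrite /resample integral0_eq// => w _; rewrite measure0. Qed.

Let resample_ge0 A : (0 <= resample mu L A)%E.
Proof. by apply: integral_ge0 => w _; exact: measure_ge0. Qed.

Let resample_sigma_additive : semi_sigma_additive (resample mu L).
Proof.
move=> F mF tF mUF; rewrite /resample.
rewrite (eq_integral (fun w => \sum_(0 <= n <oo) ker_at g L w (F n))%E); last first.
  move=> w _; apply/esym; apply: (@cvg_lim _ (@ereal_hausdorff R)).
  exact: (@measure_semi_sigma_additive _ _ _ (ker_at g L w) F mF tF mUF).
rewrite integral_nneseries//; last by move=> n; exact: measurable_ker.
by apply: is_cvg_nneseries => n _ _; exact: integral_ge0.
Qed.

HB.instance Definition _ := isMeasure.Build _ _ _ (resample mu L)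
  resample0 resample_ge0 resample_sigma_additive.

Let resample_setT : resample mu L setT = 1%E.
Proof.
rewrite /resample (eq_integral (fun=> 1%E)); last by move=> w _; exact: ker_setT.
by rewrite integral_cst// mul1e; exact: probability_setT.
Qed.

HB.instance Definition _ := Measure_isProbability.Build _ _ _ (resample mu L) resample_setT.

End Resampling.

Section Converse.
Context (R : realType) (d : nat) (E : finPointedType) (g : kernels R d E).
Local Notation Omega := (config E (site d)).
Implicit Types (K L W D U : {fset site d}) (s t w : Omega) (x y : site d).

(** Properness makes events outside [L] deterministic under the kernel. *)
Lemma ker_setI L A B w : proper_kernels g -> measurable A ->
  coord_sigma [set x | x \notin L] B ->
  ker_at g L w (A `&` B) = ((\1_B w)%:E * ker_at g L w A)%E.
Proof.
move=> pg mA cB; have mB := coord_sigma_measurable cB.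
have zero C : measurable C -> ker_at g L w C = 0%E -> ker_at g L w (A `&` C) = 0%E.
  move=> mC C0; apply/eqP; rewrite eq_le measure_ge0 andbT -C0.
  by apply: le_measure; rewrite ?inE//; exact: measurableI.
have gB := pg L B cB w; rewrite indicE in gB *.
case: (boolP (w \in B)) gB => wB gB; last by rewrite mul0e zero.
have cCB : coord_sigma [set x | x \notin L] (~` B).
  exact: (@measurableC _ (g_sigma_algebraType _) _ cB).
have gCB : ker_at g L w (~` B) = 0%E by rewrite pg// indicE in_setC wB.
rewrite mul1e (measureDI _ mA mB) setDE -[LHS]add0e; congr (_ + _)%E.
by apply/esym/zero; [exact: measurableC|exact: gCB].
Qed.

(** A cylinder splits into cylinders on a larger set, so it suffices to compare the
    measures on windows containing [L]. *)
Lemma probability_eq_cylinders (mu m : probability Omega R) L :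
  (forall L0 s, (L `<=` L0)%fset -> Pr m L0 s = Pr mu L0 s) ->
  forall A, measurable A -> m A = mu A.
Proof.
move=> h; have hP K s : Pr m K s = Pr mu K s.
  have dK (M : {fset site d}) : (K `<=` M)%fset -> dep M (\1_(cylinder K s) : Omega -> R).
    by move=> KM; exact: dep_ind.
  rewrite -!Ex_cylinder !(Ex_sumE _ (dK (L `|` K)%fset (fsubsetUr _ _))).
  by apply: eq_bigr => f _; rewrite h// fsubsetUl.
apply: (@measure_unique _ _ _ (@cylinders d E) (fun=> setT)).
- exact: measurable_cylinders.
- exact: cylinders_setI_closed.
- by move=> _; right; exists fset0, point; rewrite cylinder0.
- by rewrite bigcup_const.
- move=> A [->|[K [s ->]]]; first by rewrite !measure0.
  by transitivity (Pr m K s)%:E; [rewrite Pr_EFin|rewrite hP Pr_EFin].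
- by move=> _; rewrite (le_lt_trans (probability_le1 m measurableT)) ?ltry.
Qed.

(** A measure satisfying the single-window equations on cylinders is invariant
    under resampling, hence a Gibbs measure by properness. *)
Lemma gibbs_of_windows (mu nu : probability Omega R) : proper_kernels g -> gibbs g nu ->
  (forall L L0 s, (L `<=` L0)%fset ->
    Pr mu L0 s = \int[mu]_(w in cylinder (L0 `\` L)%fset s) spec g L s w) ->
  gibbs g mu.
Proof.
move=> pg nug dlr L A mA; split; first exact: (nug L A mA).1.
have inv : forall B, measurable B -> resample g mu L B = mu B.
  apply: (@probability_eq_cylinders mu (resample g mu L) L) => L0 s LL0.
  rewrite (dlr L)// /Pr /= /resample /Rintegral; congr fine.
  have UE : L0 = (L `|` (L0 `\` L))%fset.
    apply/fsetP => x; rewrite in_fsetU in_fsetD.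
    by case xL : (x \in L) => //=; rewrite (fsubsetP LL0).
  rewrite {1}UE cylinderU [in RHS]integral_mkcond; apply: eq_integral => w _.
  rewrite ker_setI//; [|exact: measurable_cylinder|].
    rewrite patchE indicE; case: ifP => _; last by rewrite mul0e.
    by rewrite mul1e spec_EFin.
  by apply: coord_sigma_cylinder => x /=; rewrite in_fsetD => /andP[].
move=> B cB; have mB := coord_sigma_measurable cB.
rewrite -(inv _ (measurableI _ _ mA mB)) /resample integral_mkcond.
apply: eq_integral => w _; rewrite ker_setI// patchE indicE.
by case: ifP => _; rewrite ?mul1e ?mul0e.
Qed.

End Converse.

(** * Variational principle *)

Theorem theorem7 (R : realType) (d : nat) (hd : (0 < d)%N) (E : finPointedType)
    (g : kernels R d E) (nu : probability (config E (site d)) R)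
    (V : nat -> {fset site d}) :
  specification g -> nonnull g -> spec_translation_invariant g -> quasilocal g ->
  gibbs_inv g nu ->
  V = cubes d \/ van_hove R V ->
  (forall mu : probability (config E (site d)) R, translation_invariant mu ->
     exists h : R, entropy_density_seq V mu nu n @[n --> \oo] --> h%:E) /\
  (forall mu : probability (config E (site d)) R, translation_invariant mu ->
     (gibbs_inv g mu <-> entropy_density V mu nu = 0%E)).
Proof.
move=> [pg _] ng tg qg [nug tnu] Vcase.
have VV : van_hove R V by case: Vcase => [->|//]; exact: van_hove_cubes.
have nu0 L s : 0 < Pr nu L s by exact: (gibbs_Pr_gt0 nug).
have seqE mu : entropy_density_seq V mu nu =
    EFin \o (fun n => #|` V n|%:R^-1 * kl mu nu (V n)).
  by apply/funext => n; rewrite /entropy_density_seq rel_entropyE.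
have limit mu : translation_invariant mu ->
    exists h : R, #|` V n|%:R^-1 * kl mu nu (V n) @[n --> \oo] --> h.
  move=> tmu; apply: volume_asymp_cvg => // e e0.
  exact: (kl_asymp ng tg qg nug tnu tmu e0).
have seq_cvg mu (h : R) : #|` V n|%:R^-1 * kl mu nu (V n) @[n --> \oo] --> h ->
    entropy_density_seq V mu nu n @[n --> \oo] --> h%:E.
  by move=> hh; rewrite seqE; apply: cvg_EFin => //; exact: nearW.
split=> mu tmu; first by have [h hh] := limit mu tmu; exists h; exact: seq_cvg.
have [h hh] := limit mu tmu.
have -> : entropy_density V mu nu = h%:E.
  by apply: cvg_lim; [exact: ereal_hausdorff|exact: seq_cvg].
split=> [[mug _]|[h0]].
  suff -> : h = 0 by [].
  apply/eqP; rewrite -normr_le0 leNgt; apply/negP => h_gt0.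
  have e0 : 0 < `|h| / 4 by rewrite divr_gt0.
  have near0 := volume_asymp_near VV (gibbs_kl_asymp ng tg qg mug nug e0)
    (_ : `|h| / 4 < `|h| / 2).
  have {}near0 := near0 ltac:(lra).
  move/cvgrPdist_lt : hh => /(_ _ e0) near1.
  have [n [/= n1 n2]] := filter_ex (filterI near0 near1).
  rewrite subr0 in n1; have := ler_distD (#|` V n|%:R^-1 * kl mu nu (V n)) h 0.
  rewrite !subr0; lra.
rewrite h0 in hh; split=> //; apply: (gibbs_of_windows pg nug) => L L0 s LL0.
apply: (window_dlr nug nu0 qg) => // K D e e0.
exact: (kl_small_increment tmu tnu nu0 _ _ VV hh).
Qed.
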